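(* Let $q\ge 0$ be real and let $X=(x_i)$, $Y=(y_j)$ be finite alphabets of nonnegative real numbers with $\max\{1,q\}\,x_iy_j<1$ for all $i,j$. Let $(\mu,\lambda)$ be a random pair of strict partitions with law $$\mathbb P_q^{X,Y}(\mu,\lambda)=\frac{Q_\mu(qX)Q_{\lambda/\mu}(X)P_\lambda(Y)}{\mathsf H(qX;Y)\mathsf H(X;Y)}\quad\text{if }\mu\subseteq\lambda$$ and $0$ otherwise, and set $B=|\mu|$, $R=|\lambda|-|\mu|$. Then for every $m\ge1$ the $m$th cumulants of $B$ and $R$ are $$\kappa_m(B)=2\sum_{\substack{n\ge1\\ n\text{ odd}}}n^{m-1}q^n\,p_n(X)p_n(Y),\qquad \kappa_m(R)=2\sum_{\substack{n\ge1\\ n\text{ odd}}}n^{m-1}\,p_n(X)p_n(Y).$$ Consequently, $$\kappa_m(|\lambda|)=2\sum_{\substack{n\ge1\\ n\text{ odd}}}n^{m-1}(1+q^n)\,p_n(X)p_n(Y).$$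
   Context: $|\lambda|$ is the sum of the parts of $\lambda$; $\mu\subseteq\lambda$ means $\mu_i\le\lambda_i$ for all $i$ after appending zeros. For an alphabet $A$, $p_n(A)=\sum_{a\in A}a^n$. $A+B$ denotes the union of alphabets, so $p_n(A+B)=p_n(A)+p_n(B)$; $qX=(qx_i)$. The $m$th cumulant of a random variable $V$ is $\kappa_m(V)=\frac{d^m}{ds^m}\log\mathbb E[e^{sV}]\big|_{s=0}$. Schur $Q$- and $P$-functions are the standard ones (Macdonald, Ch. III.8): with $\sum_{r\ge0}q_r(A)z^r=\prod_{a\in A}\frac{1+az}{1-az}$, one has $Q_{(r)}=q_r$, $Q_{(r,s)}=q_rq_s+2\sum_{i\ge1}(-1)^iq_{r+i}q_{s-i}$ for $r>s\ge0$, and $Q_\lambda$ is the Pfaffian of the skew-symmetric matrix with upper entries $Q_{(\lambda_i,\lambda_j)}$, $i<j$ (a zero part is appended to $\lambda$ if its length is odd); $P_\lambda=2^{-\ell(\lambda)}Q_\lambda$. Skew $Q$-functions are determined by $Q_\lambda(A+B)=\sum_{\mu\subseteq\lambda}Q_{\lambda/\mu}(A)Q_\mu(B)$. $\mathsf H(A;B)=\exp\Big(2\sum_{n\ge1,\ n\text{ odd}}\frac{p_n(A)p_n(B)}{n}\Big)$, which for finite alphabets equals $\prod_{a\in A,b\in B}\frac{1+ab}{1-ab}$. *)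

(* Defs.v *)
From HB Require Import structures.
From mathcomp Require Import all_boot all_order all_algebra.
From mathcomp Require Import all_fingroup.
From mathcomp Require Import all_classical all_reals all_analysis.
Set Implicit Arguments.
Unset Strict Implicit.
Unset Printing Implicit Defensive.
Import Order.TTheory GRing.Theory Num.Theory.
Import numFieldNormedType.Exports.
Local Open Scope classical_set_scope.
Local Open Scope ring_scope.

Record strict_partition := StrictPartition {
  parts :> seq nat;
  _ : sorted gtn parts && all (leq 1) parts }.
HB.instance Definition _ := [isSub for parts].
HB.instance Definition _ := [Countable of strict_partition by <:].

Definition weight (mu : strict_partition) : nat := sumn mu.

(* For i >= size mu the condition mu_i <= la_i reads 0 <= la_i. *)
Definition subpart (mu la : strict_partition) : bool :=
  [forall i : 'I_(size mu), (nth 0 mu i <= nth 0 la i)%N].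

Section Pfaffian.

Fact even_ord_subproof n (i : 'I_n) : (i.*2 < n.*2)%N.
Proof. by rewrite ltn_double. Qed.

Fact odd_ord_subproof n (i : 'I_n) : (i.*2.+1 < n.*2)%N.
Proof. by rewrite ltn_Sdouble. Qed.

Definition even_ord n (i : 'I_n) : 'I_(n.*2) := Ordinal (even_ord_subproof i).
Definition odd_ord n (i : 'I_n) : 'I_(n.*2) := Ordinal (odd_ord_subproof i).

Definition Pfaffian (R : numFieldType) n (M : 'M[R]_(n.*2)) : R :=
  (2 ^+ n * n`!%:R)^-1 *
  \sum_(s : 'S_(n.*2))
     (-1) ^+ s * \prod_(i < n) M (s (even_ord i)) (s (odd_ord i)).

End Pfaffian.

(* An alphabet is a finite sequence of reals; A + B is A ++ B. *)

Section SchurQ.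
Variable R : realType.
Implicit Types (A B : seq R) (la mu : strict_partition).

Definition psum n A : R := \sum_(a <- A) a ^+ n.

(* The coefficient of z^r in prod_(a in A) (1 + a z) / (1 - a z): truncating
   each geometric series 1 / (1 - a z) at degree r does not affect it. *)
Definition q_ r A : R :=
  (\prod_(a <- A) ((1 + a *: 'X) * \poly_(i < r.+1) a ^+ i))`_r.

(* Only used for r > s >= 0. *)
Definition Q2 r s A : R :=
  q_ r A * q_ s A +
  2 * \sum_(1 <= i < s.+1) (-1) ^+ i * q_ (r + i) A * q_ (s - i) A.

Definition schurQ la A : R :=
  Pfaffian (\matrix_(i < (uphalf (size la)).*2, j < (uphalf (size la)).*2)
    if (i < j)%N then Q2 (nth 0 la i) (nth 0 la j) A
    else if (j < i)%N then - Q2 (nth 0 la j) (nth 0 la i) A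
    else 0).

Definition schurP la A : R := 2 ^- size la * schurQ la A.

(* c mu = Q_(la/mu)(A).  The identity is required for all alphabets B of
   arbitrary size; as the functions B |-> Q_mu(B) are linearly independent, it
   determines c mu for every mu contained in la. *)
Definition skewQ_coefs la A (c : strict_partition -> R) : Prop :=
  forall B, schurQ la (A ++ B) =
    \sum_(mu \in [set mu | subpart mu la]) c mu * schurQ mu B.

Definition skewQ la mu A : R := xget (fun=> 0) (skewQ_coefs la A) mu.

Definition odd_sums (u : R^nat) : R^nat :=
  fun N => \sum_(1 <= n < N | odd n) u n.

Definition sfH A B : R :=
  expR (2 * limn (odd_sums (fun n => psum n A * psum n B / n%:R))).

Definition scale_alphabet (q : R) A : seq R := [seq q * x | x <- A].

Definition pair_law (q : R) (X Y : seq R) mu la : R :=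
  if subpart mu la then
    schurQ mu (scale_alphabet q X) * skewQ la mu X * schurP la Y /
    (sfH (scale_alphabet q X) Y * sfH X Y)
  else 0.

End SchurQ.

Section Cumulants.
Context d (T : measurableType d) (R : realType) (P : probability T R).
Variable V : T -> R.

Definition cgf (s : R) : R := ln (fine ('M_P V s)).

Definition cumulant (m : nat) : R := derive1n m cgf 0.

(* Both the projection [fine] and the derivative are total functions; this says
   that they are meaningful in [cumulant m]. *)
Definition cumulant_defined (m : nat) : Prop :=
  (\forall s \near (0 : R), ('M_P V s < +oo)%E) /\
  (forall k, (k < m)%N -> \forall s \near (0 : R), derivable (derive1n k cgf) s 1).

(* The m-th cumulant exists and is the sum of the convergent series with
   partial sums u. *)
Definition cumulant_is (m : nat) (u : R^nat) : Prop :=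
  cumulant_defined m /\ u @ \oo --> cumulant m.

End Cumulants.

(* Main.v *)
Require Import Defs.
From mathcomp Require Import all_boot all_order all_algebra all_fingroup.
From mathcomp Require Import ring lra zify.
From mathcomp Require Import all_classical all_reals all_analysis.
Set Implicit Arguments.
Unset Strict Implicit.
Unset Printing Implicit Defensive.
Import Order.TTheory GRing.Theory Num.Theory.
Import numFieldNormedType.Exports.
Local Open Scope classical_set_scope.
Local Open Scope ring_scope.

(** The joint generating function of the pair factors.  In the sum of
    [u^|mu| v^|la| Q_mu(qX) Q_(la/mu)(X) P_la(Y)], homogeneity and the defining
    property of the skew functions turn the sum over [mu] into
    [Q_la(vX + uvqX) P_la(Y)], and the Cauchy identity
    [sum_la Q_la(Z) P_la(Y) = prod (1 + z y) / (1 - z y)] does the sum over [la]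
    ([pair_law_gf]).  With [u] and [v] powers of [e^s], the moment generating
    function of each of the three variables is therefore a constant times a finite
    product of factors [(1 + t e^s) / (1 - t e^s)], where [t] runs over the
    [q x y], over the [x y], or over both.  Its value at [s = 0] is 1, which
    determines the constant.  Near 0 the cumulant generating function is thus a
    constant plus a finite sum of series [sum_(n odd) 2 t^n e^(n s) / n], and the
    m-th derivative at 0 multiplies the n-th terms by [n^m] ([cumulant_of_mgf]).

    The existence of the skew functions and the Cauchy identity are derived from
    the Pfaffian definition through the expansion of [Q_la(x + B)] in the
    [Q_mu(B)].  A strict partition is encoded by the configuration of particles at
    the sites given by its parts, and the coefficients of this expansion are
    products of local weights of particles that rise from [mu] to [la] ([strip]).
    Let [T] lower an index by one.  As [(1 - x T) q] for [x + B] equals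
    [(1 + x T) q] for [B], the multilinearity of the Pfaffian relates combinations
    of Pfaffians for the two alphabets in which each part is lowered by at most one
    ([pfl_shifted]).  This is a triangular linear system, and the strip weights solve
    it ([descent_strip], [descent_injective], [pfQ_cons]).  Adding variables one by
    one gives the skew functions ([skewQ_coefs_exist]).

    For the Cauchy identity, a strip up in [x] followed by a strip down in [y] can be
    exchanged at the cost of the factor [(1 + x y) / (1 - x y)].  This is an exact
    linear relation on finitely many sites, proved one site at a time
    ([up_down_train]), and a limit in the number of sites ([skew_cauchy]).  Induction
    on the alphabet [Y] gives the Pieri rule ([pieri]), and induction on [Z] the
    Cauchy identity ([cauchy_identity]); all terms are nonnegative, so the infinite
    sums may be exchanged. *)

(** * Pfaffians *)

Section PfaffianTheory.
Variable R : numFieldType.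

Lemma Pfaffian_perm n (s0 : 'S_(n.*2)) (M : 'M[R]_(n.*2)) :
  Pfaffian (\matrix_(i, j) M (s0 i) (s0 j)) = (-1) ^+ s0 * Pfaffian M.
Proof.
rewrite /Pfaffian mulrCA; congr (_ * _).
rewrite [X in _ * X](reindex_inj (mulIg s0)) /= mulr_sumr.
apply: eq_bigr => s _.
have -> : (-1) ^+ s = (-1) ^+ s0 * (-1) ^+ (s * s0)%g :> R.
  by rewrite odd_permM addbC signr_addb mulrA -expr2 sqrr_sign mul1r.
rewrite -mulrA; congr (_ * _).
by congr (_ * _); apply: eq_bigr => i _; rewrite !mxE !permM.
Qed.

(** Exchanging the two indices changes the sign of the Pfaffian but not the
    matrix. *)
Lemma Pfaffian_repeated n (M : 'M[R]_(n.*2)) i j : i != j ->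
  (forall k, M i k = M j k) -> (forall k, M k i = M k j) -> Pfaffian M = 0.
Proof.
move=> ij rowE colE; have := Pfaffian_perm (tperm i j) M.
have -> : (\matrix_(k, l) M (tperm i j k) (tperm i j l)) = M.
  by apply/matrixP=> k l; rewrite mxE; do 2 case: tpermP => [->|->|_ _] //;
    rewrite ?rowE ?colE.
rewrite odd_tperm ij expr1 mulN1r => /eqP.
by rewrite -subr_eq0 opprK -mulr2n -mulr_natr mulf_eq0 pnatr_eq0 orbF => /eqP.
Qed.

Lemma even_odd_ordP n (k : 'I_(n.*2)) :
  {i : 'I_n | k = even_ord i} + {i : 'I_n | k = odd_ord i}.
Proof.
have lt_half : (k./2 < n)%N by rewrite ltn_half_double.
have := odd_double_half k; case: odd => /= kE.
  by right; exists (Ordinal lt_half); apply: val_inj; rewrite /= -[LHS]kE.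
by left; exists (Ordinal lt_half); apply: val_inj; rewrite /= -[LHS]kE.
Qed.

Lemma even_ord_inj n : injective (@even_ord n).
Proof. by move=> i j /(congr1 val) /= /double_inj; apply: val_inj. Qed.

Lemma odd_ord_inj n : injective (@odd_ord n).
Proof. by move=> i j /(congr1 val) /= [] /double_inj; apply: val_inj. Qed.

Lemma even_odd_ord_neq n (i j : 'I_n) : (even_ord i == odd_ord j) = false.
Proof.
apply/negP=> /eqP/(congr1 (odd \o val)) /=.
by rewrite !odd_double.
Qed.

(** Every perfect matching uses the index [k] in exactly one of its entries. *)
Lemma Pfaffian_linear n (k : 'I_(n.*2)) (c : R) (A B C : 'M[R]_(n.*2)) :
  (forall i j, i != k -> j != k -> A i j = B i j /\ A i j = C i j) ->
  (forall j, A k j = B k j + c * C k j) ->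
  (forall j, A j k = B j k + c * C j k) ->
  Pfaffian A = Pfaffian B + c * Pfaffian C.
Proof.
move=> offk rowk colk; rewrite /Pfaffian mulrCA -mulrDr; congr (_ * _).
rewrite mulr_sumr -big_split; apply: eq_bigr => s _ /=.
rewrite mulrCA -mulrDr; congr (_ * _).
have key i0 :
    (forall i, i != i0 -> s (even_ord i) != k /\ s (odd_ord i) != k) ->
    A (s (even_ord i0)) (s (odd_ord i0)) =
      B (s (even_ord i0)) (s (odd_ord i0)) +
      c * C (s (even_ord i0)) (s (odd_ord i0)) ->
    \prod_(i < n) A (s (even_ord i)) (s (odd_ord i)) =
    \prod_(i < n) B (s (even_ord i)) (s (odd_ord i)) +
    c * \prod_(i < n) C (s (even_ord i)) (s (odd_ord i)).
  move=> H E; rewrite (bigD1 i0) //= [in RHS](bigD1 i0) //= [in X in _ = _ + X](bigD1 i0) //=.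
  rewrite E mulrDl -mulrA.
  have EB : \prod_(i < n | i != i0) A (s (even_ord i)) (s (odd_ord i)) =
            \prod_(i < n | i != i0) B (s (even_ord i)) (s (odd_ord i)).
    by apply: eq_bigr => i /H [H1 H2]; have [] := offk _ _ H1 H2.
  have EC : \prod_(i < n | i != i0) A (s (even_ord i)) (s (odd_ord i)) =
            \prod_(i < n | i != i0) C (s (even_ord i)) (s (odd_ord i)).
    by apply: eq_bigr => i /H [H1 H2]; have [] := offk _ _ H1 H2.
  by rewrite {1}EB EC.
have sK i : s (s^-1%g i) = i by rewrite permKV.
case: (even_odd_ordP (s^-1%g k)) => -[i0 E].
  have {}E : s (even_ord i0) = k by rewrite -E sK.
  apply: (key i0); last by rewrite E rowk.
  move=> i ne; rewrite -E !(inj_eq perm_inj); split.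
    by rewrite (inj_eq (@even_ord_inj n)).
  by rewrite eq_sym even_odd_ord_neq.
have {}E : s (odd_ord i0) = k by rewrite -E sK.
apply: (key i0); last by rewrite E colk.
move=> i ne; rewrite -E !(inj_eq perm_inj); split.
  by rewrite even_odd_ord_neq.
by rewrite (inj_eq (@odd_ord_inj n)).
Qed.

End PfaffianTheory.

Section PfaffianCap.
Variable R : numFieldType.

Lemma sum_perm_fix n (i : 'I_n.+1) (F : 'S_n.+1 -> R) :
  \sum_(s : 'S_n.+1 | s i == i) F s = \sum_(s : 'S_n) F (lift_perm i i s).
Proof.
rewrite (reindex (lift_perm i i)); last first.
  pose ulsf (s : 'S_n.+1) k := odflt k (unlift (s i) (s (lift i k))).
  have ulsfK (s : 'S_n.+1) k : lift (s i) (ulsf s k) = s (lift i k).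
    rewrite /ulsf; have := neq_lift i k.
    by rewrite -(can_eq (permK s)) => /unlift_some[] ? ? ->.
  have inj_ulsf s : injective (ulsf s).
    move=> k l E; apply: (@lift_inj _ i); apply: (@perm_inj _ s).
    by rewrite -!ulsfK E.
  exists (fun s => perm (@inj_ulsf s)) => [s _ | s].
    by apply/permP=> k; rewrite permE /ulsf lift_perm_lift lift_perm_id liftK.
  move/(s _ =P _) => si; apply/permP=> k.
  case: (unliftP i k) => [k'|] ->; rewrite ?lift_perm_id //.
  by rewrite lift_perm_lift -{1}si permE ulsfK.
by apply: eq_bigl => s; rewrite lift_perm_id eqxx.
Qed.

Definition matching_term n (M : 'M[R]_(n.*2)) (s : 'S_(n.*2)) : R :=
  (-1) ^+ s * \prod_(i < n) M (s (even_ord i)) (s (odd_ord i)).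

Lemma matching_term_flip n (M : 'M[R]_(n.*2)) i s :
  (forall k l, M l k = - M k l) ->
  matching_term M (tperm (even_ord i) (odd_ord i) * s)%g = matching_term M s.
Proof.
move=> skewM; rewrite /matching_term odd_permM odd_tperm even_odd_ord_neq /=.
rewrite (bigD1 i) //= [in RHS](bigD1 i) //= !permM tpermL tpermR.
rewrite [M (s (odd_ord i)) _]skewM.
have -> : (-1) ^+ (~~ odd_perm s) = - (-1) ^+ s :> R by rewrite signrN.
rewrite !mulNr mulrN opprK; do 2 congr (_ * _).
by apply: eq_bigr => j ji; rewrite !permM !tpermD //;
  rewrite ?(inj_eq (@even_ord_inj n)) ?(inj_eq (@odd_ord_inj n))
    ?even_odd_ord_neq // 1?eq_sym ?even_odd_ord_neq.
Qed.

Definition block_tperm n (i j : 'I_n) : 'S_(n.*2) :=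
  (tperm (even_ord i) (even_ord j) * tperm (odd_ord i) (odd_ord j))%g.

Lemma block_tperm_even n (i j k : 'I_n) :
  block_tperm i j (even_ord k) = even_ord (tperm i j k).
Proof.
rewrite permM; have -> : tperm (even_ord i) (even_ord j) (even_ord k) =
    even_ord (tperm i j k) by rewrite (inj_tperm _ _ _ (@even_ord_inj n)).
by rewrite [LHS]tpermD // eq_sym even_odd_ord_neq.
Qed.

Lemma block_tperm_odd n (i j k : 'I_n) :
  block_tperm i j (odd_ord k) = odd_ord (tperm i j k).
Proof.
rewrite permM (tpermD (z := odd_ord k)) ?even_odd_ord_neq //.
by rewrite (inj_tperm _ _ _ (@odd_ord_inj n)).
Qed.

Lemma matching_term_block n (M : 'M[R]_(n.*2)) i j s :
  matching_term M (block_tperm i j * s)%g = matching_term M s.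
Proof.
rewrite /matching_term odd_permM odd_permM !odd_tperm.
rewrite (inj_eq (@even_ord_inj n)) (inj_eq (@odd_ord_inj n)) addbb addFb.
congr (_ * _); rewrite [RHS](reindex_inj (@perm_inj _ (tperm i j))) /=.
by apply: eq_bigr => k _; rewrite !(permM (block_tperm i j))
  block_tperm_even block_tperm_odd.
Qed.

(** Up to the symmetries of a perfect matching, which account for the factor
    removed from the normalization, the last index sits in the last slot. *)
Lemma Pfaffian_last n (M : 'M[R]_(n.+1.*2)) :
  (forall k l, M l k = - M k l) ->
  Pfaffian M = (2 ^+ n * n`!%:R)^-1 *
    \sum_(s : 'S_(n.+1.*2) | s (odd_ord ord_max) == odd_ord ord_max)
      matching_term M s.
Proof.
move=> skewM; rewrite /Pfaffian -/(matching_term M).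
pose last := odd_ord (ord_max : 'I_n.+1).
rewrite (partition_big (fun s : 'S_(n.+1.*2) => s^-1%g last) predT) //=.
have move_to k (s0 : 'S_(n.+1.*2)) : s0 last = k ->
    (forall s, matching_term M (s0 * s)%g = matching_term M s) ->
    \sum_(s : 'S_(n.+1.*2) | s^-1%g last == k) matching_term M s =
    \sum_(s : 'S_(n.+1.*2) | s last == last) matching_term M s.
  move=> s0k inv; rewrite [RHS](reindex_inj (mulgI s0)) /=.
  apply: eq_big => [s|s _]; last by rewrite inv.
  by rewrite permM s0k (canF_eq (permKV s)) eq_sym.
rewrite (eq_bigr (fun=> \sum_(s : 'S_(n.+1.*2) | s last == last)
  matching_term M s)); last first.
  move=> k _; case: (even_odd_ordP k) => -[i ->].
  - apply: (move_to _ (block_tperm i ord_max * tperm (even_ord i) (odd_ord i))%g).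
      by rewrite permM block_tperm_odd tpermR tpermR.
    by move=> s; rewrite -mulgA matching_term_block matching_term_flip.
  - apply: (move_to _ (block_tperm i ord_max)) => [|s].
      by rewrite block_tperm_odd tpermR.
    exact: matching_term_block.
rewrite sumr_const card_ord -[X in _ * X]mulr_natl mulrA; congr (_ * _).
rewrite exprS factS !natrM -[n.+1.*2]muln2 natrM.
rewrite [2 * _]mulrC -mulrA [2 * (_ * _)]mulrCA !mulrA invfM.
have n1 : (n.+1%:R : R) != 0 by rewrite pnatr_eq0.
have two : (2 : R) != 0 by rewrite pnatr_eq0.
have nf : (n`!%:R : R) != 0 by rewrite pnatr_eq0 -lt0n fact_gt0.
have tn : (2 ^+ n : R) != 0 by rewrite expf_neq0.
by field; rewrite nf tn addrC natr1 n1.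
Qed.

(** Only the matchings that join the last two indices contribute, and they are
    the matchings of the remaining indices. *)
Lemma Pfaffian_cap n (M : 'M[R]_(n.+1.*2)) (M' : 'M[R]_(n.*2)) :
  (forall k l, M l k = - M k l) ->
  (forall k, M k (odd_ord ord_max) = (k == even_ord ord_max)%:R) ->
  (forall (i j : 'I_(n.*2)) (k l : 'I_(n.+1.*2)),
     i = k :> nat -> j = l :> nat -> M k l = M' i j) ->
  Pfaffian M = Pfaffian M'.
Proof.
move=> skewM lastM subM; rewrite (Pfaffian_last skewM) /Pfaffian.
congr (_ * _).
rewrite (sum_perm_fix (odd_ord (ord_max : 'I_n.+1) : 'I_n.*2.+2)).
pose pen : 'I_n.*2.+1 := ord_max.
have liftpen : lift (odd_ord (ord_max : 'I_n.+1) : 'I_n.*2.+2) pen =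
    even_ord (ord_max : 'I_n.+1).
  by apply: val_inj; rewrite /= /bump leqNgt ltnS leqnn.
rewrite (bigID (fun s : 'S_n.*2.+1 => s pen == pen)) /= [X in _ + X]big1 ?addr0.
  rewrite sum_perm_fix; apply: eq_bigr => s _.
  rewrite /matching_term !odd_lift_perm !addbb !addFb; congr (_ * _).
  rewrite big_ord_recr /= -liftpen lift_perm_lift lift_perm_id lift_perm_id.
  rewrite lastM liftpen eqxx mulr1; apply: eq_bigr => i _.
  have E (k : 'I_(n.*2)) (k' : 'I_(n.+1.*2)) : k = k' :> nat ->
      s k = lift_perm (odd_ord (ord_max : 'I_n.+1) : 'I_n.*2.+2)
              (odd_ord (ord_max : 'I_n.+1) : 'I_n.*2.+2)
              (lift_perm pen pen s) k' :> nat.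
    move=> kk.
    have -> : k' = lift (odd_ord (ord_max : 'I_n.+1) : 'I_n.*2.+2) (lift pen k).
      apply: val_inj; rewrite /= /bump [(n.*2 <= _)%N]leqNgt ltn_ord add0n.
      by rewrite leqNgt ltnS ltnW ?ltn_ord //.
    rewrite !lift_perm_lift /= /bump [(n.*2 <= _)%N]leqNgt ltn_ord add0n.
    by rewrite leqNgt ltnS ltnW ?ltn_ord.
  by apply: subM; apply: E.
move=> s spen; rewrite /matching_term big_ord_recr /= -liftpen lift_perm_lift.
rewrite lift_perm_id lastM -liftpen (inj_eq lift_inj) (negbTE spen).
by rewrite !mulr0.
Qed.

End PfaffianCap.

(** * The coefficients [q_r] and the two-row functions *)

Section QFunctions.
Variable R : realType.
Implicit Types (A B : seq R) (a x y : R).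

(** One polynomial whose coefficients up to degree [n] are all correct; the
    definition of [q_] uses a different truncation for each coefficient. *)
Definition trunc_genq n A : {poly R} :=
  \prod_(a <- A) ((1 + a *: 'X) * \poly_(i < n.+1) a ^+ i).

Lemma geometric_poly n a :
  (1 - a *: 'X) * \poly_(i < n) a ^+ i = 1 - (a ^+ n) *: 'X^n :> {poly R}.
Proof.
rewrite poly_def -exprZn -[1 in RHS](expr1n _ n) subrXX; congr (_ * _).
by apply: eq_bigr => i _; rewrite expr1n mul1r exprZn.
Qed.

Lemma trunc_genq_cons n a B :
  (1 - a *: 'X) * trunc_genq n (a :: B) =
  (1 + a *: 'X) * trunc_genq n B - a ^+ n.+1 *: 'X^(n.+1) *
    ((1 + a *: 'X) * trunc_genq n B).
Proof.
rewrite /trunc_genq big_cons !mulrA [(1 - _) * (1 + _)]mulrC.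
by rewrite -[_ * (1 - _) * _]mulrA geometric_poly; ring.
Qed.

Lemma coef_trunc_genqS n r a B : (r < n)%N ->
  (trunc_genq n (a :: B))`_r.+1 = a * (trunc_genq n (a :: B))`_r +
    ((trunc_genq n B)`_r.+1 + a * (trunc_genq n B)`_r).
Proof.
move=> rn; have := congr1 (fun p : {poly R} => p`_r.+1) (trunc_genq_cons n a B).
rewrite mulrBl mulrDl !mul1r coefB -!scalerAl coefZ [in RHS]coefB coefD !coefZ.
rewrite !coefXM /= coefXnM ltnS rn mulr0 subr0 => <-.
by rewrite addrC subrK.
Qed.

Lemma coef0_trunc_genq n A : (trunc_genq n A)`_0 = 1.
Proof.
rewrite /trunc_genq; elim: A => [|a A IH]; first by rewrite big_nil coefC.
rewrite big_cons !coef0M IH mulr1 coefD coefZ coefX coefC mulr0 addr0 mul1r.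
by rewrite coef_poly /= expr0.
Qed.

Lemma coef_trunc_genq n r A : (r <= n)%N -> (trunc_genq n A)`_r = q_ r A.
Proof.
rewrite /q_ -/(trunc_genq r A); elim: A n r => [|a A IH] n r rn.
  by rewrite /trunc_genq !big_nil.
elim: r n rn => [|r IHr] n rn; first by rewrite !coef0_trunc_genq.
rewrite !coef_trunc_genqS // !(IH n) ?(ltnW rn) // (IH r.+1 r) //.
by rewrite (IHr n) ?(ltnW rn) // (IHr r.+1).
Qed.

Lemma q0 A : q_ 0 A = 1.
Proof. exact: coef0_trunc_genq. Qed.

Lemma q_nil r : q_ r ([::] : seq R) = (r == 0)%:R.
Proof. by rewrite /q_ big_nil coefC; case: r. Qed.

Lemma qS r a B : q_ r.+1 (a :: B) = a * q_ r (a :: B) + (q_ r.+1 B + a * q_ r B).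
Proof.
rewrite -!(@coef_trunc_genq r.+1) ?leqnSn //.
exact: coef_trunc_genqS.
Qed.

Lemma q_scale r c A : q_ r (scale_alphabet c A) = c ^+ r * q_ r A.
Proof.
elim: A r => [|a A IH] r; first by rewrite !q_nil; case: r => [|r]; rewrite ?mulr1 ?mulr0.
elim: r => [|r IHr]; first by rewrite !q0 mulr1.
rewrite /= qS -/(scale_alphabet c A) !IH -/(scale_alphabet c (a :: A)) IHr qS.
by rewrite !exprS; ring.
Qed.

(** The generating function of the [q_ r A] takes inverse values at opposite
    points. *)
Lemma q_alternating r A :
  \sum_(i < r.+1) (-1) ^+ i * q_ i A * q_ (r - i) A = (r == 0)%:R.
Proof.
have [S HS] : exists S, trunc_genq r (scale_alphabet (-1) A) * trunc_genq r A =
    1 + 'X^(r.+1) * S.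
  rewrite /trunc_genq; elim: A => [|a A [S IH]].
    by exists 0; rewrite !big_nil mulr1 mulr0 addr0.
  exists (S - ((-1 * a) ^+ r.+1 *: 1 + a ^+ r.+1 *: 1 -
     ((-1 * a) ^+ r.+1 * a ^+ r.+1) *: 'X^(r.+1)) * (1 + 'X^(r.+1) * S)).
  rewrite /= !big_cons mulrACA IH.
  have E1 : (1 + (-1 * a) *: 'X) * \poly_(i < r.+1) a ^+ i =
      1 - a ^+ r.+1 *: 'X^(r.+1) :> {poly R}.
    by rewrite -geometric_poly mulN1r scaleNr.
  have E2 : (1 + a *: 'X) * \poly_(i < r.+1) (-1 * a) ^+ i =
      1 - (-1 * a) ^+ r.+1 *: 'X^(r.+1) :> {poly R}.
    by rewrite -geometric_poly mulN1r scaleNr opprK.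
  have swap (a1 p1 a2 p2 : {poly R}) : a1 * p1 * (a2 * p2) = a1 * p2 * (a2 * p1).
    by ring.
  rewrite swap E1 E2.
  by rewrite -!mul_polyC !rmorphM /=; ring.
have := congr1 (fun p : {poly R} => p`_r) HS.
rewrite coefM coefD coefXnM ltnSn addr0 coefC -mulrb => <-.
apply: eq_bigr => i _; rewrite !coef_trunc_genq ?leq_subr ?q_scale //.
by rewrite -ltnS.
Qed.

Definition Q2coef (i : nat) : R := if i is 0 then 1 else 2 * (-1) ^+ i.

Lemma Q2E r s A :
  Q2 r s A = \sum_(i < s.+1) Q2coef i * q_ (r + i) A * q_ (s - i) A.
Proof.
rewrite /Q2 big_ord_recl /= mul1r addn0 subn0; congr (_ + _).
rewrite big_add1 /= big_mkord mulr_sumr; apply: eq_bigr => i _.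
by rewrite !mulrA.
Qed.

(** The alternating sum of [q_alternating] at [s.*2] is symmetric about its
    middle term; folding it there gives [Q2 s s] up to sign. *)
Lemma Q2_diag s A : Q2 s s A = (s == 0)%:R.
Proof.
have g2 (g : nat -> R) : (forall j, (j <= s.*2)%N -> g (s.*2 - j)%N = g j) ->
    \sum_(i < s.*2.+1) g i = g s + 2 * \sum_(i < s) g (s + i.+1)%N.
  move=> gsym; rewrite -(big_mkord predT g) -addnn -addnS.
  rewrite (big_cat_nat (n := s)) ?leq_addr //=.
  rewrite -[X in \sum_(X <= _ < s + s.+1) _]add0n big_addn addKn.
  rewrite big_nat_recl // add0n big_nat_rev /= !big_mkord addrCA; congr (_ + _).
  rewrite mulr_natl mulr2n; congr (_ + _); last first.
    by apply: eq_bigr => i _; rewrite addnC.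
  apply: eq_bigr => i _; rewrite -gsym; last first.
    by have := ltn_ord i; lia.
  by congr g; have := ltn_ord i; lia.
have := q_alternating s.*2 A.
rewrite (g2 (fun i => (-1) ^+ i * q_ i A * q_ (s.*2 - i) A)); last first.
  move=> j js; rewrite subKn // -signr_odd oddB // odd_double addFb signr_odd.
  by rewrite mulrAC.
move=> E; have {}E : (-1) ^+ s * Q2 s s A = (s.*2 == 0)%N%:R.
  rewrite -E /Q2 mulrDr !mulrA; congr (_ + _).
    by rewrite -addnn addnK.
  rewrite [_ * 2]mulrC -mulrA; congr (_ * _).
  rewrite big_add1 /= big_mkord mulr_sumr; apply: eq_bigr => i _.
  by rewrite exprD -addnn subnDl; ring.
rewrite -[LHS]mul1r -(sqrr_sign _ s) expr2 -mulrA E double_eq0.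
by case: s {E g2} => [|s]; rewrite ?mulr1 ?mulr0.
Qed.

(** The shifts of the two indices act on the two factors of each summand, so
    the combination [(1 + y T1) (1 + y T2) Q2] involves the coefficients only
    through [(1 + y T) q]. *)
Lemma Q2_shift y r s A :
  let w k := q_ k.+1 A + y * q_ k A in
  Q2 r.+1 s.+1 A + y * Q2 r s.+1 A + y * Q2 r.+1 s A + y ^+ 2 * Q2 r s A =
  \sum_(i < s.+1) Q2coef i * w (r + i)%N * w (s - i)%N +
  Q2coef s.+1 * w (r + s.+1)%N.
Proof.
move=> w; rewrite !Q2E.
rewrite big_ord_recr [in X in _ + y * X + _ + _]big_ord_recr /= !subnn q0 !mulr1.
have -> : \sum_(i < s.+1) Q2coef i * w (r + i)%N * w (s - i)%N =
    \sum_(i < s.+1) Q2coef i * q_ (r.+1 + i) A * q_ (s.+1 - i) A +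
    y * (\sum_(i < s.+1) Q2coef i * q_ (r + i) A * q_ (s.+1 - i) A) +
    y * (\sum_(i < s.+1) Q2coef i * q_ (r.+1 + i) A * q_ (s - i) A) +
    y ^+ 2 * (\sum_(i < s.+1) Q2coef i * q_ (r + i) A * q_ (s - i) A).
  rewrite !mulr_sumr -!big_split /=; apply: eq_bigr => i _.
  by rewrite /w subSn ?addSn; [ring | rewrite -ltnS].
by rewrite /w -addSn; ring.
Qed.

(** The generating functions of [x :: B] and [B] satisfy [(1 - x z) Q_(x :: B)(z)
    = (1 + x z) Q_B(z)], hence [(1 - x T) q] at [x :: B] is [(1 + x T) q] at [B]. *)
Lemma Q2_cons x r s B :
  Q2 r.+1 s.+1 (x :: B) - x * Q2 r s.+1 (x :: B) - x * Q2 r.+1 s (x :: B) +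
    x ^+ 2 * Q2 r s (x :: B) =
  Q2 r.+1 s.+1 B + x * Q2 r s.+1 B + x * Q2 r.+1 s B + x ^+ 2 * Q2 r s B.
Proof.
have shiftE k : q_ k.+1 (x :: B) - x * q_ k (x :: B) = q_ k.+1 B + x * q_ k B.
  by rewrite qS; ring.
have := Q2_shift (- x) r s (x :: B); rewrite /= sqrrN.
under eq_bigr do rewrite !mulNr !shiftE.
rewrite !mulNr shiftE => ->; by rewrite Q2_shift.
Qed.

Lemma Q2_nil r s : (s < r)%N -> Q2 r s ([::] : seq R) = 0.
Proof.
case: r => // r _; rewrite Q2E big1 // => i _.
by rewrite q_nil addSn mulr0 mul0r.
Qed.

End QFunctions.

(** * Pfaffians over lists of labels *)

Lemma double_uphalf n : (uphalf n).*2 = (n + odd n)%N.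
Proof. by rewrite uphalf_half doubleD -addnn -addnA odd_double_half addnC. Qed.

Lemma leq_double_uphalf n : (n <= (uphalf n).*2)%N.
Proof. by rewrite double_uphalf leq_addr. Qed.

Lemma lt_double_uphalf n j : (j < (uphalf n).*2)%N -> (j <= n)%N.
Proof. by rewrite double_uphalf; lia. Qed.

Lemma uphalf_odd n : odd n -> uphalf n.+1 = uphalf n.
Proof. by rewrite /= uphalf_half; lia. Qed.

Section PfaffianFunctional.
Variable R : realType.
Implicit Types (A B : seq R) (x y : R).

(** The antisymmetric extension of [Q2] to pairs of indices, with an additional
    index [None]. *)
Definition wick B (k l : option nat) : R :=
  match k, l with
  | Some r, Some s =>
      if (s < r)%N then Q2 r s B else if (r < s)%N then - Q2 s r B else 0
  | Some r, None => q_ r B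
  | None, Some s => - q_ s B
  | None, None => 0
  end.

Lemma wick_skew B k l : wick B l k = - wick B k l.
Proof.
case: k l => [r|] [s|] /=; rewrite ?opprK ?oppr0 //.
by case: ltngtP; rewrite ?opprK ?oppr0.
Qed.

(** Labels are formal linear combinations of indices: a list of labels then
    stands for a multilinear expansion of Pfaffians. *)
Definition label := seq (R * option nat).

Definition pairing B (u v : label) : R :=
  \sum_(a <- u) \sum_(b <- v) a.1 * b.1 * wick B a.2 b.2.

Lemma pairing_skew B u v : pairing B v u = - pairing B u v.
Proof.
rewrite /pairing exchange_big -sumrN; apply: eq_bigr => a _.
rewrite -sumrN; apply: eq_bigr => b _.
by rewrite wick_skew mulrN [b.1 * _]mulrC.
Qed.

Lemma pairing_self B u : pairing B u u = 0.
Proof.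
have /eqP := pairing_skew B u u.
by rewrite -subr_eq0 opprK -mulr2n -mulr_natr mulf_eq0 pnatr_eq0 orbF => /eqP.
Qed.

Definition site (r : nat) : label := [:: (1, Some r)].
Definition star : label := [:: (1, None)].
Definition shifted y (r : nat) : label := [:: (1, Some r); (y, Some r.-1)].

Definition pairingE := (big_cons, big_nil, addr0, mul1r, mulr1).

Lemma pairing_shifted_star x r B : (0 < r)%N ->
  pairing (x :: B) (shifted (- x) r) star = pairing B (shifted x r) star.
Proof.
by case: r => // r _; rewrite /pairing !pairingE /= qS; ring.
Qed.

Lemma pairing_shifted x r s B : (0 < r)%N -> (0 < s)%N ->
  pairing (x :: B) (shifted (- x) r) (shifted (- x) s) =
  pairing B (shifted x r) (shifted x s).
Proof.
wlog sr : r s / (s <= r)%N.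
  move=> W r0 s0; case: (leqP s r) => [sr|/ltnW rs]; first exact: W.
  by rewrite pairing_skew W // -pairing_skew.
rewrite leq_eqVlt in sr; case/predU1P: sr => [->|sr].
  by rewrite !pairing_self.
case: r s sr => // r [//|s]; rewrite ltnS => sr _ _.
have subdiag C : wick C (Some r) (Some s.+1) = Q2 r s.+1 C.
  by rewrite /=; case: (ltngtP s.+1 r) sr => // <- _; rewrite Q2_diag.
rewrite /pairing !pairingE !subdiag /= !ltnS sr (ltnW sr).
by have := Q2_cons x r s B; rewrite /=; lra.
Qed.

Definition pfn B n (s : seq label) : R :=
  Pfaffian (\matrix_(i < n.*2, j < n.*2)
    pairing B (nth star s i) (nth star s j)).

(** A list of odd length is completed by [star] ([nth star] does this), which
    pairs with every site [r] to [q_ r], also with the site 0.  The site 0 pairs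
    with positive sites in the same way but with itself to 0, for which
    [pairing_shifted_star] would fail at [r = 1]. *)
Definition pfl B (s : seq label) : R := pfn B (uphalf (size s)) s.

Lemma schurQ_pfl la B : schurQ la B = pfl B (map site la).
Proof.
rewrite /schurQ /pfl /pfn size_map; congr (Pfaffian _).
case: la => la /= /andP[la_sorted la_pos].
have lt_size (j : 'I_((uphalf (size la)).*2)) : (j <= size la)%N.
  exact: lt_double_uphalf.
have pos i : (i < size la)%N -> (0 < nth 0 la i)%N by move/(all_nthP 0): la_pos; apply.
have decr i j : (i < j)%N -> (j <= size la)%N -> (nth 0 la j < nth 0 la i)%N.
  move=> ij; rewrite leq_eqVlt => /predU1P[jE|js].
    by rewrite jE nth_default // pos // -jE.
  apply: (sorted_ltn_nth _ 0%N la_sorted); rewrite ?inE //; last exact: ltn_trans js.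
  by move=> a b c /= ba cb; apply: ltn_trans ba.
have entry (i j : 'I_((uphalf (size la)).*2)) : (i < j)%N ->
    pairing B (nth star (map site la) i) (nth star (map site la) j) =
    Q2 (nth 0 la i) (nth 0 la j) B.
  move=> ij; have ila := leq_trans ij (lt_size j).
  rewrite (nth_map 0) //; have := lt_size j; rewrite leq_eqVlt => /predU1P[jE|jla].
    have -> : nth 0%N la j = 0%N by rewrite nth_default ?jE.
    have -> : nth star (map site la) j = star by rewrite nth_default ?size_map ?jE.
    by rewrite /pairing !pairingE /= /Q2 big_geq // mulr0 addr0 q0 mulr1.
  by rewrite (nth_map 0) // /pairing !pairingE /= decr // ltnW.
apply/matrixP => i j; rewrite !mxE; case: ltngtP => [ij|ji|ij].
- by rewrite entry.
- by rewrite pairing_skew entry.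
- by rewrite ij pairing_self.
Qed.

Lemma pfl_repeated B s1 u s2 : pfl B (s1 ++ u :: u :: s2) = 0.
Proof.
rewrite /pfl; set n := uphalf _.
have sn : ((size s1).+1 < n.*2)%N.
  by rewrite (leq_trans _ (leq_double_uphalf _)) // size_cat /= !addnS !ltnS leq_addr.
have nth0u : nth star (s1 ++ u :: u :: s2) (size s1) = u.
  by rewrite nth_cat ltnn subnn.
have nth1u : nth star (s1 ++ u :: u :: s2) (size s1).+1 = u.
  by rewrite nth_cat ltnNge leqnSn /= subSnn.
apply: (Pfaffian_repeated (i := Ordinal (ltnW sn)) (j := Ordinal sn)).
- by rewrite -val_eqE /= neq_ltn ltnSn.
- by move=> k; rewrite !mxE /= nth0u nth1u.
- by move=> k; rewrite !mxE /= nth0u nth1u.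
Qed.

Lemma pfl_linear B s1 c u v w s2 :
  (forall t, pairing B w t = pairing B u t + c * pairing B v t) ->
  pfl B (s1 ++ w :: s2) = pfl B (s1 ++ u :: s2) + c * pfl B (s1 ++ v :: s2).
Proof.
move=> H; have sz z : size (s1 ++ z :: s2) = (size s1 + (size s2).+1)%N.
  by rewrite size_cat.
rewrite /pfl !sz; set n := uphalf _.
have sn : (size s1 < n.*2)%N
  by rewrite (leq_trans _ (leq_double_uphalf _)) // addnS ltnS leq_addr.
have nthz z z' (i : 'I_n.*2) : i != Ordinal sn ->
    nth star (s1 ++ z :: s2) i = nth star (s1 ++ z' :: s2) i.
  rewrite -val_eqE /= => ne; rewrite !nth_cat; case: ltnP => // le.
  by case E : (i - size s1)%N => //; case/eqP: ne; lia.
have nthk z : nth star (s1 ++ z :: s2) (size s1) = z.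
  by rewrite nth_cat ltnn subnn.
have diag z : pairing B z z = 0 by apply: pairing_self.
apply: (Pfaffian_linear (k := Ordinal sn)) => [i j ik jk|j|j]; rewrite !mxE /=.
- by split; congr pairing; apply: nthz.
- case: (eqVneq j (Ordinal sn)) => [->|jk]; last first.
    by rewrite !nthk H (nthz w u) // (nthz v u).
  by rewrite /= !nthk !diag mulr0 addr0.
- case: (eqVneq j (Ordinal sn)) => [->|jk]; last first.
    by rewrite !nthk pairing_skew H (nthz w u) // (nthz v u) // opprD -mulrN -!pairing_skew.
  by rewrite /= !nthk !diag mulr0 addr0.
Qed.

(** The matrices on the two sides have the same entries: the relation between the
    coefficients for [x :: B] and for [B] is bilinear in the labels. *)
Lemma pfl_shifted x s B : all (leq 1) s ->
  pfl (x :: B) (map (shifted (- x)) s) = pfl B (map (shifted x) s).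
Proof.
move=> spos; rewrite /pfl !size_map /pfn; congr Pfaffian.
apply/matrixP => i j; rewrite !mxE.
have pos k : (k < size s)%N -> (0 < nth 0 s k)%N by move/(all_nthP 0): spos; apply.
case: (ltnP i (size s)) => [is_|si]; last first.
  rewrite [nth star _ i]nth_default ?size_map // [in RHS]nth_default ?size_map //.
  case: (ltnP j (size s)) => [js|sj]; last first.
    by rewrite !nth_default ?size_map // !pairing_self.
  by rewrite !(nth_map 0) // pairing_skew pairing_shifted_star ?pos // -pairing_skew.
rewrite !(nth_map 0 _ _ is_).
case: (ltnP j (size s)) => [js|sj]; last first.
  by rewrite ![nth star _ j]nth_default ?size_map // pairing_shifted_star ?pos.
by rewrite !(nth_map 0) // pairing_shifted ?pos.
Qed.

(** A final site 0 may be dropped.  It pairs with the positive sites as [star]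
    does, so it can serve as the completion of a list of odd length; a list of
    even length is completed by [star], and subtracting the label of site 0
    from that of [star] decouples the two from the rest. *)
Lemma pfl_zero s B : all (leq 1) s ->
  pfl B (rcons (map site s) (site 0)) = pfl B (map site s).
Proof.
move=> spos.
have pos k : (k < size s)%N -> (0 < nth 0 s k)%N by move/(all_nthP 0): spos; apply.
have Kzero r : (0 < r)%N -> wick B (Some r) (Some 0%N) = q_ r B.
  by move=> r0; rewrite /= r0 /Q2 big_geq // mulr0 addr0 q0 mulr1.
have [odd_s|even_s] := boolP (odd (size s)).
  rewrite /pfl size_rcons size_map.
  rewrite uphalf_odd //.
  rewrite /pfn; congr Pfaffian; apply/matrixP => i j; rewrite !mxE.
  have le_size (k : 'I_((uphalf (size s)).*2)) : (k <= size s)%N.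
    exact: lt_double_uphalf.
  have lab (k : 'I_((uphalf (size s)).*2)) :
      nth star (rcons (map site s) (site 0)) k =
      if k == size s :> nat then site 0 else nth star (map site s) k.
    rewrite nth_rcons size_map; have := le_size k.
    by case: ltngtP.
  have off (k : 'I_((uphalf (size s)).*2)) : k != size s :> nat ->
      pairing B (nth star (map site s) k) (site 0) =
      pairing B (nth star (map site s) k) star.
    move=> ks; have kl : (k < size s)%N by rewrite ltn_neqAle ks le_size.
    by rewrite (nth_map 0) // /pairing !pairingE Kzero // pos.
  rewrite !lab; case: (eqVneq (nat_of_ord i) (size s)) => [is_|is_];
    case: (eqVneq (nat_of_ord j) (size s)) => [js|js] //.
  - by rewrite is_ js !pairing_self.
  - by rewrite pairing_skew off // -pairing_skew is_
      [nth star _ (size s)]nth_default ?size_map.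
  - by rewrite off // js [nth star _ (size s)]nth_default ?size_map.
pose D : label := [:: (1, None); (-1, Some 0%N)].
have DE t : pairing B D t = pairing B star t + (-1) * pairing B (site 0) t.
  rewrite /pairing !pairingE !mulr_sumr; congr (_ + _).
  by apply: eq_bigr => b _; rewrite mul1r mulrA.
have -> : pfl B (rcons (map site s) (site 0)) =
    pfl B ((rcons (map site s) (site 0)) ++ [:: D]).
  rewrite (pfl_linear _ _ DE) [X in _ + _ * X](_ : _ = 0) ?mulr0 ?addr0; last first.
    by rewrite cat_rcons pfl_repeated.
  rewrite /pfl size_cat !size_rcons size_map addn1.
  rewrite (@uphalf_odd (size s).+1) //.
  rewrite /pfn; congr Pfaffian; apply/matrixP => i j; rewrite !mxE.
  rewrite cats1 ![nth _ (rcons (rcons _ _) _) _]nth_rcons.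
  have lab (k : nat) : (if (k < size (rcons (map site s) (site 0)))%N
      then nth star (rcons (map site s) (site 0)) k
      else if k == size (rcons (map site s) (site 0)) then star else star) =
      nth star (rcons (map site s) (site 0)) k.
    by case: ltnP => // le; rewrite if_same nth_default.
  by rewrite !lab.
rewrite /pfl size_cat !size_rcons size_map addn1.
have szE : size s = (uphalf (size s)).*2 by rewrite double_uphalf (negbTE even_s) addn0.
have -> : uphalf (size s).+2 = (uphalf (size s)).+1 by [].
apply: Pfaffian_cap => [k l|k|i j k l ik jl]; rewrite !mxE.
- exact: pairing_skew.
- rewrite -val_eqE /= -szE cat_rcons.
  have -> : nth star (map site s ++ [:: site 0; D]) (size s).+1 = D.
    by rewrite nth_cat size_map ltnNge leqnSn /= subSnn.
  rewrite nth_cat size_map; case: ltngtP => [ks|ks|->].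
  + rewrite (nth_map 0) // pairing_skew DE /pairing !pairingE /=.
    by rewrite pos // /Q2 big_geq // mulr0 addr0 q0; ring.
  + have -> : nat_of_ord k = (size s).+1.
      by have := ltn_ord k; rewrite /= in ks *; lia.
    by rewrite subSnn /= pairing_self.
  + by rewrite subnn /= /pairing !pairingE /= q0 mulr0 addr0.
- have lt_size (t : 'I_((uphalf (size s)).*2)) : (t < size s)%N.
    by rewrite [X in (_ < X)%N]szE.
  by rewrite -ik -jl cat_rcons !nth_cat size_map !lt_size.
Qed.

End PfaffianFunctional.
Arguments site {R} r.
Arguments star {R}.

(** * Particle configurations and the branching rule *)

Fixpoint bits n : seq (seq bool) :=
  if n is n'.+1 then map (cons false) (bits n') ++ map (cons true) (bits n')
  else [:: [::]].

Lemma mem_bits n l : (l \in bits n) = (size l == n).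
Proof.
elim: n l => [|n IH] [|b l] //=; rewrite mem_cat.
  by apply/negbTE/norP; split; apply/mapP => -[].
have E c : (b :: l \in map (cons c) (bits n)) = (b == c) && (size l == n).
  apply/mapP/andP => [[k kn [-> ->]]|[/eqP-> ln]]; first by rewrite eqxx -IH.
  by exists l; rewrite ?IH.
by rewrite !E eqSS; case: b {E}; rewrite /= ?orbF.
Qed.

Lemma uniq_bits n : uniq (bits n).
Proof.
elim: n => //= n IH; rewrite cat_uniq !map_inj_uniq ?IH; try by move=> ? ? [].
by rewrite andbT; apply/hasPn => _ /mapP[k _ ->]; apply/mapP => -[].
Qed.

(** A bit list is a configuration of particles, one for each part of a strict
    partition; its head is the highest site and its last entry is site 1. *)
Fixpoint occupied (l : seq bool) : seq nat :=
  if l is b :: l' then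
    if b then (size l').+1 :: occupied l' else occupied l'
  else [::].

Lemma occupied_pos l : all (leq 1) (occupied l).
Proof. by elim: l => //= -[]. Qed.

Section Transfer.
Variable R : realType.
Implicit Types (x y : R) (l m : seq bool) (F G : seq bool -> R).

Lemma sum_bitsS n F :
  \sum_(l <- bits n.+1) F l =
  \sum_(l <- bits n) F (false :: l) + \sum_(l <- bits n) F (true :: l).
Proof. by rewrite /= big_cat !big_map. Qed.

Lemma eq_sum_bits n F G : (forall l, size l = n -> F l = G l) ->
  \sum_(l <- bits n) F l = \sum_(l <- bits n) G l.
Proof.
by move=> FG; apply: eq_big_seq => l; rewrite mem_bits => /eqP; apply: FG.
Qed.

Lemma sum_bits_step n F G (F' G' : bool -> seq bool -> R) (a b : bool -> bool -> R) :
  (forall c k, F (c :: k) = a c false * F' false k + a c true * F' true k) ->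
  (forall c k, G (c :: k) = b c false * G' false k + b c true * G' true k) ->
  let S h g := \sum_(k <- bits n) F' h k * G' g k in
  let c h g := a false h * b false g + a true h * b true g in
  \sum_(k <- bits n.+1) F k * G k =
  c false false * S false false + c false true * S false true +
  c true false * S true false + c true true * S true true.
Proof.
move=> FE GE S c; rewrite sum_bitsS /S !mulr_sumr -!big_split /=.
by apply: eq_bigr => k _; rewrite !FE !GE /c; ring.
Qed.

(** The total weight of the ways in which the particles of [m] rise to those of
    [l].  The edge above the top site is crossed if [h], and crossing the edge
    below site 1 creates a particle, with weight [w].  In the weight [v b h c g]
    of a site, [b] and [c] are its states in [l] and [m], and [h] and [g] those of
    the edges above and below it. *)
Fixpoint transfer (v : bool -> bool -> bool -> bool -> R) (w : bool -> R)
    (l m : seq bool) (h : bool) : R :=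
  match l, m with
  | [::], [::] => w h
  | b :: l', c :: m' =>
      v b h c false * transfer v w l' m' false +
      v b h c true * transfer v w l' m' true
  | _, _ => 0
  end.

Definition boundary x (h : bool) : R := if h then x else 1.

(** Each crossed edge has weight [x] and each maximal run of crossed edges a
    factor 2, at the site where it stops: this is the skew function
    [Q_(l/m)(x)] of one variable, for a horizontal strip [l/m]. *)
Definition strip_vertex x (b h c g : bool) : R :=
  match b, h, c, g with
  | false, false, false, false => 1
  | false, true, false, true => x
  | true, false, false, true => 2
  | true, false, true, false => 1
  | false, true, true, false => x
  | true, true, true, true => x
  | _, _, _, _ => 0
  end.

Definition strip x := transfer (strip_vertex x) (boundary x).

(** Going from [l] down to [m], each particle stays or descends by one site with
    weight [x]. *)
Definition descent_vertex x (b h c g : bool) : R :=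
  match b, h, c, g with
  | false, false, false, false => 1
  | true, false, false, true => 1
  | true, false, true, false => 1
  | false, true, true, false => x
  | true, true, true, true => x
  | _, _, _, _ => 0
  end.

Definition descent x := transfer (descent_vertex x) (boundary x).

Lemma strip_cons x b l c m h : strip x (b :: l) (c :: m) h =
  strip_vertex x b h c false * strip x l m false +
  strip_vertex x b h c true * strip x l m true.
Proof. by []. Qed.

Lemma descent_cons x b l c m h : descent x (b :: l) (c :: m) h =
  descent_vertex x b h c false * descent x l m false +
  descent_vertex x b h c true * descent x l m true.
Proof. by []. Qed.

(** On single particles, [strip] is [(1 + x T) / (1 - x T)] and [descent] is
    [1 + x T].  Of the four states of the two top edges, the two combinations
    below are enough for an induction on the number of sites. *)
Lemma descent_strip x n l m : size l = n -> size m = n ->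
  let W h g := \sum_(k <- bits n) descent (- x) l k h * strip x k m g in
  W false false = descent x l m false /\
  2 * W false true + W true false = descent x l m true.
Proof.
elim: n l m => [|n IH] [|b l] [|c m] //= => [_ _|[ln] [mn]].
  by rewrite !big_seq1 /descent /strip /=; split; ring.
have [/= IH0 IH1] := IH l m ln mn.
have step h g := sum_bits_step n
  (F := fun k => descent (- x) (b :: l) k h) (G := fun k => strip x k (c :: m) g)
  (F' := fun h' k => descent (- x) l k h') (G' := fun g' k => strip x k m g')
  (a := descent_vertex (- x) b h) (b := fun a => strip_vertex x a g c)
  (fun a k => erefl) (fun a k => erefl).
rewrite /= in step; rewrite !step !descent_cons -IH0 -IH1.
by case: b {step}; case: c => /=; split; ring.
Qed.

Fixpoint multishift y (s : seq nat) (Phi : seq nat -> R) : R :=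
  if s is r :: s' then
    multishift y s' (fun t => Phi (r :: t)) +
    y * multishift y s' (fun t => Phi (r.-1 :: t))
  else Phi [::].

Lemma multishift0 y s Phi : (forall t, Phi t = 0) -> multishift y s Phi = 0.
Proof.
elim: s Phi => [|r s IH] Phi H //=.
by rewrite (IH (fun t => Phi (r :: t))) // (IH (fun t => Phi (r.-1 :: t))) //
  mulr0 addr0.
Qed.

(** Lowering some parts of a decreasing list by one gives a weakly decreasing
    list, and those with a repetition contribute 0; the others are configurations
    in which a particle descending from site 1 has disappeared.  The second
    equality describes a particle arriving at the top site from above. *)
Lemma multishift_descent y n l (Phi : seq nat -> R) : size l = n ->
  (forall s1 r s2, Phi (s1 ++ r :: r :: s2) = 0) ->
  (forall s, all (leq 1) s -> Phi (rcons s 0%N) = Phi s) ->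
  multishift y (occupied l) Phi =
    \sum_(m <- bits n) descent y l m false * Phi (occupied m) /\
  y * multishift y (occupied l) (fun t => Phi (n :: t)) =
    \sum_(m <- bits n) descent y l m true * Phi (occupied m).
Proof.
elim: n l Phi => [|n IH] [|b l] // Phi; last first.
  move=> [ln] rep zero.
  have [IH0 IH1] := IH l Phi ln rep zero.
  have [|s spos|IHn0 IHn1] := IH l (fun t => Phi (n.+1 :: t)) ln.
  - by move=> s1 r s2; rewrite -cat_cons rep.
  - by rewrite -rcons_cons zero.
  have sz0 h : \sum_(m <- bits n) descent y (b :: l) (false :: m) h *
        Phi (occupied (false :: m)) =
     descent_vertex y b h false false *
       \sum_(m <- bits n) descent y l m false * Phi (occupied m) +
     descent_vertex y b h false true *
       \sum_(m <- bits n) descent y l m true * Phi (occupied m).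
    by rewrite !mulr_sumr -big_split; apply: eq_bigr => m _; rewrite descent_cons /=; ring.
  have sz1 h : \sum_(m <- bits n) descent y (b :: l) (true :: m) h *
        Phi (occupied (true :: m)) =
     descent_vertex y b h true false *
       \sum_(m <- bits n) descent y l m false * Phi (n.+1 :: occupied m) +
     descent_vertex y b h true true *
       \sum_(m <- bits n) descent y l m true * Phi (n.+1 :: occupied m).
    rewrite !mulr_sumr -big_split; apply: eq_sum_bits => m mn /=.
    by rewrite mn descent_cons; ring.
  rewrite !sum_bitsS !sz0 !sz1 -IH0 -IH1 -IHn0 -IHn1.
  case: b {sz0 sz1} => /=; rewrite ?ln; split; try ring.
  rewrite (@multishift0 y (occupied l) (fun t => Phi (n.+1 :: n.+1 :: t))); first by ring.
  by move=> t; apply: (rep [::]).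
by move=> _ rep zero; rewrite !big_seq1 /descent /= mul1r (zero [::]).
Qed.

(** With respect to the state of the top site the matrix [descent] is block
    triangular, both diagonal blocks being the matrix for one site less. *)
Lemma descent_injective y n F :
  (forall l, size l = n -> \sum_(m <- bits n) descent y l m false * F m = 0) ->
  forall l, size l = n -> F l = 0.
Proof.
elim: n F => [|n IH] F H.
  by case=> // _; have := H [::] erefl; rewrite big_seq1 /descent /= mul1r.
have F0 l : size l = n -> F (false :: l) = 0.
  move=> ln; apply: (IH (fun m => F (false :: m))) => // k kn.
  have := H (false :: k); rewrite /= kn => /(_ erefl).
  rewrite (sum_bitsS n (fun m => _ * F m)) [X in _ + X = _ -> _]big1 ?addr0; last first.
    by move=> m _; rewrite descent_cons /=; ring.
  by move=> E; rewrite -[RHS]E; apply: eq_bigr => m _; rewrite descent_cons /=; ring.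
have F1 l : size l = n -> F (true :: l) = 0.
  move=> ln; apply: (IH (fun m => F (true :: m))) => // k kn.
  have := H (true :: k); rewrite /= kn => /(_ erefl).
  rewrite (sum_bitsS n (fun m => _ * F m)).
  rewrite [X in X + _]big1_seq ?add0r; last first.
    by move=> m; rewrite mem_bits => /andP[_ /eqP mn]; rewrite F0 // mulr0.
  by move=> E; rewrite -[RHS]E; apply: eq_bigr => m _; rewrite descent_cons /=; ring.
by case=> // -[] l [ln]; [apply: F1 | apply: F0].
Qed.

Definition pfQ B l := pfl B (map site (occupied l)) : R.

Lemma pfl_multishift y s1 s B : all (leq 1) s ->
  pfl B (map site s1 ++ map (shifted y) s) =
  multishift y s (fun t => pfl B (map site (s1 ++ t))).
Proof.
elim: s s1 => [|r s IH] s1 /=; first by rewrite !cats0.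
case/andP=> r0 spos.
rewrite (pfl_linear _ _ (u := site r) (c := y) (v := site r.-1)); last first.
  by move=> t; rewrite /pairing !pairingE mulr_sumr; congr (_ + _);
    apply: eq_bigr => b _ /=; ring.
rewrite -!cat_rcons -!map_rcons !IH //.
by congr (_ + y * _); congr multishift; apply/funext => t; rewrite cat_rcons.
Qed.

Lemma pfQ_descent y n l B : size l = n ->
  pfl B (map (shifted y) (occupied l)) =
  \sum_(m <- bits n) descent y l m false * pfQ B m.
Proof.
move=> ln; rewrite (pfl_multishift y [::] B (occupied_pos l)).
have [|s spos|-> //] := @multishift_descent y n l (fun t => pfl B (map site t)) ln.
  by move=> s1 r s2; rewrite map_cat pfl_repeated.
by rewrite map_rcons pfl_zero.
Qed.

(** Branching rule.  Both sides solve the linear system with the invertible matrix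
    [descent (- x)], by [pfl_shifted] and [descent_strip]. *)
Lemma pfQ_cons x n l B : size l = n ->
  pfQ (x :: B) l = \sum_(m <- bits n) strip x l m false * pfQ B m.
Proof.
move=> ln; apply/eqP; rewrite -subr_eq0; apply/eqP.
pose D l := pfQ (x :: B) l - \sum_(m <- bits n) strip x l m false * pfQ B m.
apply: (@descent_injective (- x) n D) ln => k kn.
under eq_bigr do rewrite mulrBr mulr_sumr.
rewrite big_split /= sumrN -(pfQ_descent (- x)) // pfl_shifted ?occupied_pos //.
rewrite (pfQ_descent x B kn) exchange_big /= -sumrB big1_seq // => m.
rewrite mem_bits => /andP[_ /eqP mn].
have [<- _] := descent_strip x kn mn.
by rewrite mulr_suml -sumrB big1 // => j _; ring.
Qed.

End Transfer.

(** * Commutation of strips on finitely many sites *)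

Section SkewCauchyBits.
Variable R : realType.
Implicit Types (x y : R) (k l m p : seq bool).

Definition two_pow l : R := 2 ^+ size (occupied l).

Lemma two_pow_cons b l : two_pow (b :: l) = (if b then 2 else 1) * two_pow l.
Proof. by rewrite /two_pow; case: b; rewrite /= ?mul1r // exprS. Qed.

(** The factor [(two_pow l)^-1] turns one of the two strip weights from that of
    a [Q]-function into that of a [P]-function, up to a factor independent of [l];
    [down_up] has the corresponding factor for [k]. *)
Definition up_down x y n m p h g :=
  \sum_(l <- bits n) (two_pow l)^-1 * strip x l m h * strip y l p g.

Definition down_up x y n m p h g :=
  \sum_(k <- bits n)
    two_pow k / (two_pow m * two_pow p) * strip x p k h * strip y m k g.

Lemma up_down_cons x y n b c m p h g : size m = n -> size p = n ->
  up_down x y n.+1 (b :: m) (c :: p) h g =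
  let w u v := strip_vertex x false h b u * strip_vertex y false g c v +
    strip_vertex x true h b u * strip_vertex y true g c v / 2 in
  w false false * up_down x y n m p false false +
  w false true * up_down x y n m p false true +
  w true false * up_down x y n m p true false +
  w true true * up_down x y n m p true true.
Proof.
move=> mn pn; rewrite /up_down.
rewrite (sum_bits_step n (G := fun l => strip y l (c :: p) g)
  (F' := fun u l => (two_pow l)^-1 * strip x l m u)
  (G' := fun v l => strip y l p v)
  (a := fun a u => (if a then 2 else 1)^-1 * strip_vertex x a h b u)
  (b := fun a v => strip_vertex y a g c v)) //=; last first.
  by move=> a l; rewrite two_pow_cons invfM strip_cons; ring.
by rewrite invr1; congr (_ * _ + _ * _ + _ * _ + _ * _); ring.
Qed.

Lemma down_up_cons x y n b c m p h g : size m = n -> size p = n ->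
  down_up x y n.+1 (b :: m) (c :: p) h g =
  let w u v := (strip_vertex x c h false u * strip_vertex y b g false v +
    2 * strip_vertex x c h true u * strip_vertex y b g true v) /
      ((if b then 2 else 1) * (if c then 2 else 1)) in
  w false false * down_up x y n m p false false +
  w false true * down_up x y n m p false true +
  w true false * down_up x y n m p true false +
  w true true * down_up x y n m p true true.
Proof.
move=> mn pn; rewrite /down_up.
rewrite (sum_bits_step n (G := fun k => strip y (b :: m) k g)
  (F' := fun u k => two_pow k / (two_pow m * two_pow p) * strip x p k u)
  (G' := fun v k => strip y m k v)
  (a := fun a u => (if a then 2 else 1) /
     ((if b then 2 else 1) * (if c then 2 else 1)) * strip_vertex x c h a u)
  (b := fun a v => strip_vertex y b g a v)) //=; last first.
  move=> a k; rewrite !two_pow_cons !invfM strip_cons.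
  by move: (if b then _ else _)^-1 (if c then _ else _)^-1
    (if a then _ else _) (two_pow m)^-1 (two_pow p)^-1 => u v w s t; ring.
rewrite /down_up; move: (_ * (if c then _ else _))^-1 => u.
by congr (_ * _ + _ * _ + _ * _ + _ * _); ring.
Qed.

(** Commuting the two strips past one site amounts to conjugation by a fixed
    matrix on the states of the two top edges, so the relation passes from each
    site to the next, starting from the boundary below site 1. *)
Lemma up_down_train x y n m p : 1 + x * y != 0 -> size m = n -> size p = n ->
  let A := up_down x y n m p in let B := down_up x y n m p in
  [/\ A false true = B false true, A true false = B true false,
    (1 + x * y) * B false false =
      (1 - x * y) * A false false + 2 * A true true &
    (1 + x * y) * B true true =
      2 * x * y * A false false - (1 - x * y) * A true true].
Proof.
move=> xy; elim: n m p => [|n IH] [|b m] [|c p] //= => [_ _|[mn] [pn]].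
  have two0 : two_pow [::] = 1 by rewrite /two_pow /= expr0.
  rewrite /up_down /down_up !big_seq1 two0 /strip /= !invr1 !mul1r invr1.
  by split; ring.
have [/= E1 E2 E3 E4] := IH m p mn pn.
rewrite !up_down_cons // !down_up_cons //=.
move: E1 E2 E3 E4.
set A00 := up_down _ _ _ _ _ false false; set A01 := up_down _ _ _ _ _ false true.
set A10 := up_down _ _ _ _ _ true false; set A11 := up_down _ _ _ _ _ true true.
set B00 := down_up _ _ _ _ _ false false; set B01 := down_up _ _ _ _ _ false true.
set B10 := down_up _ _ _ _ _ true false; set B11 := down_up _ _ _ _ _ true true.
move=> <- <- E3 E4.
have {}E3 : B00 = ((1 - x * y) * A00 + 2 * A11) / (1 + x * y).
  by rewrite -E3 mulrC mulKf.
have {}E4 : B11 = (2 * x * y * A00 - (1 - x * y) * A11) / (1 + x * y).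
  by rewrite -E4 mulrC mulKf.
rewrite E3 E4.
by case: b; case: c; rewrite /= ?(mul0r, mulr0, addr0, add0r, mul1r, mulr1, invr1);
  split; field.
Qed.

Lemma strip_ge0 x l m h : 0 <= x -> 0 <= strip x l m h.
Proof.
move=> x0; elim: l m h => [|b l IH] [|c m] h //=; first by case: h; rewrite //= ler01.
by rewrite strip_cons addr_ge0 // mulr_ge0 //; case: b; case: h; case: c => //=;
  rewrite ?ler01 ?ler0n.
Qed.

(** Particles move up and never overtake; one that leaves through the top edge is
    counted at site [n.+1]. *)
Lemma strip_dominated x n l m h i : size l = n -> size m = n -> strip x l m h != 0 ->
  (nth 0 (occupied m) i <= nth 0 (if h then n.+1 :: occupied l else occupied l) i)%N.
Proof.
elim: n l m h i => [|n IH] [|b l] [|c m] // h i; first by rewrite /= !nth_nil.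
move=> [ln] [mn]; rewrite strip_cons /= ln mn.
have IHl g j : strip x l m g != 0 -> _ := IH l m g j ln mn.
case: b; case: h; case: c => /=; rewrite ?(mul0r, mulr0, addr0, add0r, mul1r) ?eqxx //.
- rewrite mulf_eq0 negb_or => /andP[_ /IHl H].
  by case: i => //= i; apply: H.
- by move=> /IHl H; case: i => //= i; apply: H.
- by rewrite mulf_eq0 negb_or => /andP[_ /IHl]; apply.
- rewrite mulf_eq0 negb_or => /andP[_ /IHl H].
  by case: i => //= i; apply: H.
- rewrite mulf_eq0 negb_or => /andP[_ /IHl H].
  by apply: leq_trans (H i) _; case: i.
- by move/IHl; apply.
Qed.

(** The exponent of [x] in the weight of a strip is the number of boxes added;
    the particle leaving through the top edge stands for a part [n.+1]. *)
Lemma strip_scale c x n l m h : size l = n -> size m = n ->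
  strip (c * x) l m h * c ^+ sumn (occupied m) =
  c ^+ ((if h then n.+1 else 0) + sumn (occupied l)) * strip x l m h.
Proof.
elim: n l m h => [|n IH] [|b l] [|d m] // h.
  by move=> _ _; case: h; rewrite /strip /= ?mulr1 // expr1.
move=> [ln] [mn]; pose e (g : bool) := if g then n.+1 else 0%N.
have occE a k : size k = n ->
    sumn (occupied (a :: k)) = (e a + sumn (occupied k))%N.
  by move=> kn; case: a => //=; rewrite kn.
have IHe g : strip (c * x) l m g * c ^+ sumn (occupied m) =
    c ^+ e g * c ^+ sumn (occupied l) * strip x l m g by rewrite IH // exprD.
have regroup (v0 v1 s0 s1 u w : R) :
    (v0 * s0 + v1 * s1) * (u * w) = u * (v0 * (s0 * w) + v1 * (s1 * w)) by ring.
rewrite !strip_cons !occE // !exprD regroup !IHe /e.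
by case: b; case: h; case: d; rewrite /= ?expr0 ?exprS; ring.
Qed.

End SkewCauchyBits.

(** * Sums of nonnegative families *)

Section SumsOverCountableTypes.
Variables (R : realType) (T : choiceType).
Implicit Types (F : T -> R) (c : R).
Local Open Scope ereal_scope.

Lemma esum_setT_swap (T' : choiceType) (a : T -> T' -> \bar R) :
  (forall i j, 0 <= a i j) ->
  \esum_(i in setT) \esum_(j in setT) a i j =
  \esum_(j in setT) \esum_(i in setT) a i j.
Proof.
move=> a0; rewrite (esum_esum (J := fun=> setT)) //.
rewrite (esum_esum (J := fun=> setT) (fun j i _ _ => a0 i j)).
rewrite (reindex_esum (setT `*`` (fun=> setT)) (setT `*`` (fun=> setT))
  (fun k : T' * T => (k.2, k.1))) //.
split=> //; first by move=> [i j] [k l] _ _ [-> ->].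
by move=> [i j] _; exists (j, i).
Qed.

Lemma esum_mul_le c F : (0 <= c)%R -> (forall i, 0 <= F i)%R ->
  \esum_(i in setT) (c * F i)%:E <= c%:E * \esum_(i in setT) (F i)%:E.
Proof.
move=> c0 F0; apply: ge_ereal_sup => _ [X [finX XT] <-].
under eq_fsbigr do rewrite EFinM.
rewrite -ge0_mule_fsumr; last by move=> i; rewrite lee_fin.
by apply: lee_wpmul2l; rewrite ?lee_fin // esum_ge //; exists X.
Qed.

(** The reverse of [esum_mul_le] is the same inequality for [c^-1]. *)
Lemma esum_mul c F : (0 <= c)%R -> (forall i, 0 <= F i)%R ->
  \esum_(i in setT) (c * F i)%:E = c%:E * \esum_(i in setT) (F i)%:E.
Proof.
rewrite le_eqVlt => /predU1P[<- _|c0 F0].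
  by rewrite mul0e esum1 // => i _; rewrite mul0r.
apply/eqP; rewrite eq_le esum_mul_le ?(ltW c0) //=.
have F1 i : (0 <= c * F i)%R by rewrite mulr_ge0 // ltW.
have := @esum_mul_le c^-1 (fun i => c * F i)%R.
rewrite invr_ge0 (ltW c0) => /(_ isT F1) le1.
have le2 : c%:E * (\esum_(i in setT) (F i)%:E) <=
    c%:E * (c^-1%:E * (\esum_(i in setT) (c * F i)%:E)).
  apply: lee_wpmul2l; first by rewrite lee_fin ltW.
  apply: le_trans le1; apply: le_esum => i _.
  by rewrite mulKf // gt_eqF.
by rewrite muleA -EFinM divff ?gt_eqF // mul1e in le2.
Qed.

Lemma esum_exhaust (r : nat -> seq T) F c :
  (forall n, uniq (r n)) ->
  (forall i, \forall n \near \oo, i \in r n) ->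
  (forall i, 0 <= F i)%R ->
  ((fun n => \sum_(i <- r n) F i)%R @ \oo --> c) ->
  \esum_(i in setT) (F i)%:E = c%:E.
Proof.
move=> ur cover F0 cvg_c.
have cvg_cE : (fun n => (\sum_(i <- r n) F i)%R%:E) @ \oo --> c%:E.
  by apply: cvg_EFin => //; apply: nearW.
have partial n : (\sum_(i <- r n) F i)%R%:E = \sum_(i \in [set` r n]) (F i)%:E.
  by rewrite -sumEFin -fsbig_seq.
apply/eqP; rewrite eq_le; apply/andP; split.
  apply: ge_ereal_sup => _ [X [finX _] <-].
  apply: (cvge_to_ge cvg_cE).
  have sub : \forall n \near \oo, X `<=` [set` r n].
    have [s ->] := (finite_seqP X).1 finX.
    elim: s => [|i s IH]; first by apply: nearW => n j.
    near=> n => j; rewrite /= inE => /predU1P[->|js].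
      by near: n; apply: cover.
    by move: j js; near: n.
  near=> n; rewrite partial; apply: lee_fsum_nneg_subset => //.
    by apply/subsetP; rewrite ?inE; near: n.
  by move=> i _; rewrite lee_fin.
apply: (cvge_to_le cvg_cE); apply: nearW => n; rewrite partial.
by apply: esum_ge; exists [set` r n].
Unshelve. all: by end_near.
Qed.

End SumsOverCountableTypes.

(** * Strict partitions as particle configurations *)

Fixpoint tobits n (s : seq nat) : seq bool :=
  if n is n'.+1 then (n \in s) :: tobits n' s else [::].

Lemma size_tobits n s : size (tobits n s) = n.
Proof. by elim: n => //= n ->. Qed.

Lemma occupied_le l i : i \in occupied l -> (i <= size l)%N.
Proof.
elim: l => //= b l IH; case: b => [|/IH/leqW //].
by rewrite inE => /predU1P[->//|/IH/leqW].
Qed.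

Lemma gtn_transitive : transitive gtn.
Proof. by move=> j i k /= ij jk; apply: ltn_trans jk ij. Qed.

Lemma occupied_sorted l : sorted gtn (occupied l).
Proof.
elim: l => //= -[] //= l IH; rewrite (path_sortedE gtn_transitive) IH andbT.
by apply/allP => i /occupied_le.
Qed.

Lemma mem_occupied_tobits n s i :
  (i \in occupied (tobits n s)) = (0 < i <= n)%N && (i \in s).
Proof.
elim: n => [|n IH]; first by case: i.
rewrite /= size_tobits [(i <= n.+1)%N]leq_eqVlt ltnS.
case: ifP => ns; rewrite ?inE IH; case: eqVneq => [->|_] //=; rewrite ?ns //.
by rewrite ltnn !andbF.
Qed.

Lemma tobits_occupied l : tobits (size l) (occupied l) = l.
Proof.
have ext n s t : {in [pred i | (i <= n)%N], s =i t} -> tobits n s = tobits n t.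
  elim: n => //= n IH E; rewrite E ?inE //; congr (_ :: _).
  by apply: IH => i le_in; rewrite E // inE leqW.
elim: l => //= b l IH; congr (_ :: _); last first.
  rewrite -[RHS]IH; apply: ext => i; rewrite inE => il.
  by case: b => //; rewrite inE ltn_eqF.
case: b; first by rewrite mem_head.
by apply/negP => /occupied_le; rewrite ltnn.
Qed.

Fact occupied_strict l : sorted gtn (occupied l) && all (leq 1) (occupied l).
Proof. by rewrite occupied_sorted occupied_pos. Qed.

Definition of_bits l : strict_partition := StrictPartition (occupied_strict l).

Definition to_bits n (la : strict_partition) := tobits n la.

Definition largest (la : strict_partition) : nat := head 0%N la.

Lemma le_largest (la : strict_partition) i : i \in parts la -> (i <= largest la)%N.
Proof.
case: la => [[|j la] laP] //=; case/andP: (laP) => la_sorted _; rewrite /largest /= inE.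
case/predU1P => [->//|]; move: (la_sorted : path gtn j la).
rewrite (path_sortedE gtn_transitive) => /andP[/allP H _] /H.
exact: ltnW.
Qed.

Lemma of_bitsK l : to_bits (size l) (of_bits l) = l.
Proof. exact: tobits_occupied. Qed.

Lemma to_bitsK n (la : strict_partition) : (largest la <= n)%N ->
  of_bits (to_bits n la) = la.
Proof.
move=> la_n; apply: val_inj; apply: (irr_sorted_eq gtn_transitive).
- exact: ltnn.
- exact: occupied_sorted.
- by case: (la) => s /= /andP[].
move=> i; rewrite mem_occupied_tobits; apply: andb_idl => ila.
rewrite (leq_trans (le_largest ila)) // andbT.
by case: (la) ila => s /= /andP[_ /allP] H /H.
Qed.

Lemma occupied_to_bits n (la : strict_partition) : (largest la <= n)%N ->
  occupied (to_bits n la) = la.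
Proof. by move/to_bitsK/(congr1 parts). Qed.

Lemma largest_of_bits l : (largest (of_bits l) <= size l)%N.
Proof.
rewrite /largest /=; case E : (occupied l) => [//|i s] /=.
by apply: occupied_le; rewrite E mem_head.
Qed.

Lemma to_bitsS n (la : strict_partition) : (largest la <= n)%N ->
  to_bits n.+1 la = false :: to_bits n la.
Proof.
move=> la_n; rewrite /to_bits /=; congr (_ :: _); apply/negP => /le_largest.
by rewrite leqNgt ltnS la_n.
Qed.

Definition partitions n : seq strict_partition := map of_bits (bits n).

Lemma mem_partitions n la : (la \in partitions n) = (largest la <= n)%N.
Proof.
apply/mapP/idP => [[l]|la_n].
  by rewrite mem_bits => /eqP <- ->; apply: largest_of_bits.
exists (to_bits n la); last by rewrite to_bitsK.
by rewrite mem_bits size_tobits.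
Qed.

Lemma uniq_partitions n : uniq (partitions n).
Proof.
rewrite map_inj_in_uniq ?uniq_bits // => k l.
rewrite !mem_bits => /eqP kn /eqP ln kl.
by rewrite -[k]of_bitsK -[l]of_bitsK kn ln kl.
Qed.

Lemma sum_partitions (R : realType) n (F : strict_partition -> R) :
  \sum_(la <- partitions n) F la = \sum_(l <- bits n) F (of_bits l).
Proof. by rewrite big_map. Qed.

Lemma near_partitions la : \forall n \near \oo, la \in partitions n.
Proof. by exists (largest la) => // n /=; rewrite mem_partitions. Qed.

Section StripWeights.
Variable R : realType.
Implicit Types (x y : R) (A B X Y Z : seq R) (la mu nu ka : strict_partition).

(** The skew function [Q_(la/mu)(x)] of one variable; any larger number of sites
    gives the same value. *)
Definition Qstrip x la mu : R :=
  let n := maxn (largest la) (largest mu) in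
  strip x (to_bits n la) (to_bits n mu) false.

Lemma QstripE x n la mu : (largest la <= n)%N -> (largest mu <= n)%N ->
  Qstrip x la mu = strip x (to_bits n la) (to_bits n mu) false.
Proof.
move=> la_n mu_n; rewrite /Qstrip.
have: (maxn (largest la) (largest mu) <= n)%N by rewrite geq_max la_n.
move/subnK <-; elim: (n - _)%N => // k IH; rewrite addSn.
have kla : (largest la <= k + maxn (largest la) (largest mu))%N.
  exact: leq_trans (leq_maxl _ _) (leq_addl _ _).
have kmu : (largest mu <= k + maxn (largest la) (largest mu))%N.
  exact: leq_trans (leq_maxr _ _) (leq_addl _ _).
by rewrite !to_bitsS // strip_cons /= mul1r mul0r addr0.
Qed.

Lemma Qstrip_ge0 x la mu : 0 <= x -> 0 <= Qstrip x la mu.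
Proof. exact: strip_ge0. Qed.

Lemma Qstrip_subpart x la mu : Qstrip x la mu != 0 -> subpart mu la.
Proof.
rewrite /Qstrip; set n := maxn _ _ => H.
have := strip_dominated _ (size_tobits n la) (size_tobits n mu) H.
rewrite /= !occupied_to_bits ?leq_maxl ?leq_maxr // => le_parts.
by apply/forallP => i; apply: le_parts.
Qed.

Lemma subpart_largest mu la : subpart mu la -> (largest mu <= largest la)%N.
Proof.
move/forallP; rewrite /largest; case: mu => -[|i mu] //= _ H.
by have := H (Ordinal (ltn0Sn (size mu))); rewrite /= nth0.
Qed.

Lemma schurQ_of_bits l B : schurQ (of_bits l) B = pfQ B l.
Proof. exact: schurQ_pfl. Qed.

Lemma schurQ_cons x la B n : (largest la <= n)%N ->
  schurQ la (x :: B) = \sum_(mu <- partitions n) Qstrip x la mu * schurQ mu B.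
Proof.
move=> la_n; rewrite -[in LHS](to_bitsK la_n) schurQ_of_bits sum_partitions.
rewrite (pfQ_cons x B (size_tobits n la)); apply: eq_sum_bits => l ln.
have l_n : (largest (of_bits l) <= n)%N by rewrite -ln largest_of_bits.
by rewrite (QstripE x la_n l_n) -[in to_bits n (of_bits l)]ln of_bitsK schurQ_of_bits.
Qed.

Lemma schurQ_empty B : schurQ (of_bits [::]) B = 1.
Proof.
rewrite schurQ_pfl /pfl /pfn /Pfaffian /= expr0 mul1r invr1 mul1r.
rewrite (big_pred1 1%g) => [|s]; last by apply/esym/eqP/permP => -[].
by rewrite odd_perm1 big_ord0 mulr1.
Qed.

Lemma schurQ_nil la : schurQ la ([::] : seq R) = (largest la == 0%N)%:R.
Proof.
rewrite schurQ_pfl /pfl size_map; case: la => -[_|i la laP] /=;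
  last case/andP: (laP) => la_sorted la_pos.
  by rewrite -(schurQ_empty [::]) schurQ_pfl.
have pos k : (k < size (i :: la))%N -> (0 < nth 0 (i :: la) k)%N.
  by move/(all_nthP 0%N): la_pos; apply.
rewrite /largest /= gtn_eqF; last exact: (pos 0%N).
rewrite /pfn /Pfaffian [X in _ * X]big1 ?mulr0 // => s _.
rewrite (bigD1 ord0) //= mulrCA [X in X * _ = _](_ : _ = 0) ?mul0r //.
have q0r r : (0 < r)%N -> q_ r ([::] : seq R) = 0 by rewrite q_nil; case: r.
have Q0 r t : wick ([::] : seq R) (Some r) (Some t) = 0.
  by rewrite /=; case: ltngtP => [rt|rt|//]; rewrite Q2_nil ?oppr0.
rewrite mxE -!map_cons; set k := s _; set k' := s _.
have lab (u : nat) : nth star (map site (i :: la)) u = star :> label R \/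
    exists2 r, (0 < r)%N & nth star (map site (i :: la)) u = site r :> label R.
  case: (ltnP u (size (i :: la))) => [lt|le]; last first.
    by left; rewrite nth_default ?size_map.
  by right; exists (nth 0 (i :: la) u); rewrite ?pos // (nth_map 0%N).
by case: (lab k) => [->|[r r0 ->]]; case: (lab k') => [->|[r' r'0 ->]];
  rewrite /pairing !pairingE ?Q0 //= ?q0r // oppr0.
Qed.

End StripWeights.

(** * The skew Cauchy identity in two variables *)

Section SkewCauchyIdentity.
Variable R : realType.
Implicit Types (x y : R) (A B X Y Z : seq R) (la mu nu ka : strict_partition).

Lemma schurQ_ge0 la A : (forall a, a \in A -> 0 <= a) -> 0 <= schurQ la A.
Proof.
elim: A la => [|a A IH] la A0; first by rewrite schurQ_nil ler0n.
rewrite (schurQ_cons a A (leqnn _)) sumr_ge0 // => mu _.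
apply: mulr_ge0; first by apply: Qstrip_ge0; apply: A0; rewrite mem_head.
by apply: IH => b bA; apply: A0; rewrite inE bA orbT.
Qed.

Definition updown_weight x y mu nu la : R :=
  2 ^- size la * Qstrip x la mu * Qstrip y la nu.

Definition downup_weight x y mu nu ka : R :=
  2 ^+ size ka / (2 ^+ size mu * 2 ^+ size nu) * Qstrip x nu ka * Qstrip y mu ka.

Lemma updown_weight_ge0 x y mu nu la : 0 <= x -> 0 <= y ->
  0 <= updown_weight x y mu nu la.
Proof. by move=> x0 y0; rewrite !mulr_ge0 ?Qstrip_ge0 // invr_ge0 exprn_ge0. Qed.

Lemma downup_weight_ge0 x y mu nu ka : 0 <= x -> 0 <= y ->
  0 <= downup_weight x y mu nu ka.
Proof.
move=> x0 y0; by rewrite !mulr_ge0 ?Qstrip_ge0 ?exprn_ge0 // invr_ge0 mulr_ge0 ?exprn_ge0.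
Qed.

Lemma two_pow_to_bits n la : (largest la <= n)%N ->
  two_pow R (to_bits n la) = 2 ^+ size la.
Proof. by move=> la_n; rewrite /two_pow occupied_to_bits. Qed.

Lemma of_bits_to_bits_size n l : size l = n ->
  to_bits n (of_bits l) = l /\ (largest (of_bits l) <= n)%N.
Proof. by move<-; rewrite of_bitsK largest_of_bits. Qed.

Lemma sum_updown n x y mu nu : (largest mu <= n)%N -> (largest nu <= n)%N ->
  \sum_(la <- partitions n) updown_weight x y mu nu la =
  up_down x y n (to_bits n mu) (to_bits n nu) false false.
Proof.
move=> mu_n nu_n; rewrite sum_partitions; apply: eq_sum_bits => l ln.
have [lE l_n] := of_bits_to_bits_size ln.
by rewrite /updown_weight !(@QstripE _ _ n) // lE.
Qed.

Lemma sum_downup n x y mu nu : (largest mu <= n)%N -> (largest nu <= n)%N ->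
  \sum_(ka <- partitions n) downup_weight x y mu nu ka =
  down_up x y n (to_bits n mu) (to_bits n nu) false false.
Proof.
move=> mu_n nu_n; rewrite sum_partitions; apply: eq_sum_bits => l ln.
have [lE l_n] := of_bits_to_bits_size ln.
by rewrite /downup_weight !(@QstripE _ _ n) // lE !two_pow_to_bits.
Qed.

(** For partitions with parts at most [n] this is [up_down_train], with an error
    from the configurations where both top edges are crossed.  There a particle
    rises through all the sites above the parts of [mu] and [nu] in both strips,
    so that the error decays like [(x * y) ^+ n]. *)
Lemma skew_cauchy x y mu nu : 0 <= x -> 0 <= y -> x * y < 1 ->
  (\esum_(la in setT) (updown_weight x y mu nu la)%:E =
  ((1 + x * y) / (1 - x * y))%:E *
    (\esum_(ka in setT) (downup_weight x y mu nu ka)%:E))%E.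
Proof.
move=> x0 y0 xy1; have xy0 : 0 <= x * y by rewrite mulr_ge0.
pose N := maxn (largest mu) (largest nu).
have mu_n n : (largest mu <= n + N)%N by rewrite (leq_trans (leq_maxl _ _) (leq_addl _ _)).
have nu_n n : (largest nu <= n + N)%N by rewrite (leq_trans (leq_maxr _ _) (leq_addl _ _)).
pose a n := up_down x y (n + N) (to_bits (n + N) mu) (to_bits (n + N) nu).
pose b n := down_up x y (n + N) (to_bits (n + N) mu) (to_bits (n + N) nu).
have bE n : b n false false = b 0%N false false.
  elim: n => // n <-; rewrite /b addSn !to_bitsS //.
  rewrite down_up_cons ?size_tobits //=.
  by rewrite ?(mul0r, mulr0, addr0, mul1r, divr1).
have aE n : a n true true = (x * y) ^+ n * a 0%N true true.
  elim: n => [|n IH]; first by rewrite mul1r.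
  rewrite exprS -mulrA -IH /a addSn !to_bitsS // up_down_cons ?size_tobits //=.
  by rewrite ?(mul0r, mulr0, addr0, add0r).
have train n : a n false false = (1 + x * y) / (1 - x * y) * b 0%N false false -
    2 / (1 - x * y) * (x * y) ^+ n * a 0%N true true.
  have ne : 1 + x * y != 0 by rewrite gt_eqF // ltr_wpDr.
  have [_ _ E _] := up_down_train ne (size_tobits (n + N) mu) (size_tobits (n + N) nu).
  rewrite -/(to_bits _ _) -/(to_bits _ _) -/(a n) -/(b n) bE aE in E.
  have ne' : 1 - x * y != 0 by rewrite subr_eq0 gt_eqF.
  have -> : a n false false =
      ((1 + x * y) * b 0%N false false - 2 * ((x * y) ^+ n * a 0%N true true)) /
        (1 - x * y).
    by rewrite E addrK mulrC mulKf.
  by field.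
have down_cvg : (fun n => \sum_(ka <- partitions n) downup_weight x y mu nu ka)
    @ \oo --> b 0%N false false.
  rewrite -(cvg_shiftn N); apply: cvg_near_cst; apply: nearW => n.
  by rewrite /= sum_downup // -(bE n).
have up_cvg : (fun n => \sum_(la <- partitions n) updown_weight x y mu nu la)
    @ \oo --> (1 + x * y) / (1 - x * y) * b 0%N false false.
  rewrite -(cvg_shiftn N).
  have : (fun n => a n false false) @ \oo -->
      (1 + x * y) / (1 - x * y) * b 0%N false false.
    under eq_fun do rewrite train.
    set t := _ * b 0%N false false.
    have pow0 : (fun n => (x * y) ^+ n) @ \oo --> (0 : R).
      by apply: cvg_expr; rewrite ger0_norm.
    have lim_t : (fun n => t - 2 / (1 - x * y) * (x * y) ^+ n * a 0%N true true)
        @ \oo --> t - 2 / (1 - x * y) * 0 * a 0%N true true.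
      exact: (cvgB (cvg_cst t) (cvgMr_tmp (cvgMl_tmp pow0))).
    by rewrite mulr0 mul0r subr0 in lim_t.
  apply: cvg_trans; apply: near_eq_cvg; apply: nearW => n.
  by rewrite /= sum_updown.
rewrite (esum_exhaust (uniq_partitions) near_partitions _ down_cvg); last first.
  by move=> ka; apply: downup_weight_ge0.
rewrite -EFinM; apply: (esum_exhaust uniq_partitions near_partitions _ up_cvg).
by move=> la; apply: updown_weight_ge0.
Qed.

End SkewCauchyIdentity.

(** * The Pieri rule and the Cauchy identity *)

Section CauchyIdentity.
Variable R : realType.
Implicit Types (x y : R) (A B X Y Z : seq R) (la mu nu ka : strict_partition).

Definition empty_partition : strict_partition := of_bits [::].

Lemma largest_eq0 la : (largest la == 0%N) = (la == empty_partition).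
Proof. by rewrite -leqn0 -mem_partitions inE. Qed.

Lemma esum_empty_partition (F : strict_partition -> R) :
  (forall la, 0 <= F la) -> (forall la, la != empty_partition -> F la = 0) ->
  (\esum_(la in setT) (F la)%:E = (F empty_partition)%:E)%E.
Proof.
move=> F0 Fne; transitivity (\esum_(la in [set empty_partition]) (F la)%:E)%E; last first.
  by rewrite esum_set1 ?lee_fin.
rewrite [RHS]esum_mkcond; apply: eq_esum => la _; case: ifPn => //.
by rewrite notin_setE /= => /eqP ne; rewrite Fne.
Qed.

Lemma esum_schurQ_cons y la B : 0 <= y -> (forall b, b \in B -> 0 <= b) ->
  (\esum_(mu in setT) (Qstrip y la mu * schurQ mu B)%:E =
   (schurQ la (y :: B))%:E)%E.
Proof.
move=> y0 B0; apply: (esum_exhaust uniq_partitions near_partitions) => [mu|].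
  by rewrite mulr_ge0 ?Qstrip_ge0 ?schurQ_ge0.
apply: cvg_near_cst; exists (largest la) => // n /= la_n.
by rewrite -schurQ_cons.
Qed.

Definition cauchy_factor x Y : R := \prod_(y <- Y) ((1 + x * y) / (1 - x * y)).

Lemma factor_ge0 x y : 0 <= x -> 0 <= y -> x * y < 1 ->
  0 <= (1 + x * y) / (1 - x * y).
Proof.
move=> x0 y0 xy1; apply: divr_ge0; first by rewrite addr_ge0 ?mulr_ge0.
by rewrite subr_ge0 ltW.
Qed.

Lemma cauchy_factor_ge0 x Y : 0 <= x ->
  (forall y, y \in Y -> 0 <= y /\ x * y < 1) -> 0 <= cauchy_factor x Y.
Proof.
move=> x0 HY; rewrite /cauchy_factor big_seq prodr_ge0 // => y /HY[y0 xy1].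
exact: factor_ge0.
Qed.

Lemma schurP_ge0 la A : (forall a, a \in A -> 0 <= a) -> 0 <= schurP la A.
Proof. by move=> A0; rewrite mulr_ge0 ?schurQ_ge0 // invr_ge0 exprn_ge0. Qed.

(** By induction on [Y]: expand [Q_la] along the first variable [y], exchange the
    strips in [x] and [y] by the skew Cauchy identity, sum the strips in [x] by
    the induction hypothesis, and collect the strips in [y] again. *)
Lemma pieri x Y mu : 0 <= x -> (forall y, y \in Y -> 0 <= y /\ x * y < 1) ->
  (\esum_(la in setT) (Qstrip x la mu * schurP la Y)%:E =
   (cauchy_factor x Y * schurP mu Y)%:E)%E.
Proof.
move=> x0; elim: Y mu => [|y Y IH] mu HY.
  rewrite /cauchy_factor big_nil mul1r esum_empty_partition; first last.
  - by move=> la ne; rewrite /schurP schurQ_nil largest_eq0 (negbTE ne) !mulr0.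
  - by move=> la; rewrite mulr_ge0 ?Qstrip_ge0 ?schurP_ge0.
  congr EFin; rewrite /schurP !schurQ_nil !largest_eq0 eqxx.
  have [->|ne] := eqVneq mu empty_partition.
    by rewrite /Qstrip /strip /= mul1r.
  have [->|H] := eqVneq (Qstrip x empty_partition mu) 0; first by rewrite mul0r mulr0.
  have := subpart_largest (Qstrip_subpart H); rewrite leqn0 largest_eq0.
  by rewrite (negbTE ne).
have [y0 xy1] := HY y (mem_head _ _).
have HY' z : z \in Y -> 0 <= z /\ x * z < 1 by move=> zY; apply: HY; rewrite inE zY orbT.
have {}IH := IH ^~ HY'.
have Y0 z : z \in Y -> 0 <= z by move=> /HY'[].
pose C := (1 + x * y) / (1 - x * y).
have pow_ge0 k : 0 <= 2 ^- k :> R by rewrite invr_ge0 exprn_ge0.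
have C0 : 0 <= C by apply: factor_ge0.
transitivity (\esum_(la in setT) \esum_(nu in setT)
    (schurQ nu Y * updown_weight x y mu nu la)%:E)%E.
  apply: eq_esum => la _; rewrite /schurP mulrA EFinM -esum_schurQ_cons // -esum_mul.
  - by apply: eq_esum => nu _; congr EFin; rewrite /updown_weight; ring.
  - by rewrite mulr_ge0 ?Qstrip_ge0 // invr_ge0 exprn_ge0.
  - by move=> nu; rewrite mulr_ge0 ?Qstrip_ge0 ?schurQ_ge0.
rewrite esum_setT_swap; last first.
  by move=> la nu; rewrite lee_fin mulr_ge0 ?schurQ_ge0 ?updown_weight_ge0.
transitivity (\esum_(nu in setT) \esum_(ka in setT)
    (C * schurQ nu Y * downup_weight x y mu nu ka)%:E)%E.
  apply: eq_esum => nu _; rewrite esum_mul; first last.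
  - by move=> la; apply: updown_weight_ge0.
  - exact: schurQ_ge0.
  rewrite skew_cauchy // esum_mul; first last.
  - by move=> ka; apply: downup_weight_ge0.
  - by rewrite mulr_ge0 ?schurQ_ge0.
  by rewrite muleA -EFinM mulrC.
rewrite esum_setT_swap; last first.
  by move=> nu ka; rewrite lee_fin mulr_ge0 ?downup_weight_ge0 // mulr_ge0 ?schurQ_ge0.
transitivity (\esum_(ka in setT) (C * cauchy_factor x Y * 2 ^- size mu *
    (Qstrip y mu ka * schurQ ka Y))%:E)%E.
  apply: eq_esum => ka _.
  transitivity (\esum_(nu in setT) (C * 2 ^+ size ka * 2 ^- size mu * Qstrip y mu ka *
     (Qstrip x nu ka * schurP nu Y))%:E)%E.
    apply: eq_esum => nu _; congr EFin; rewrite /downup_weight /schurP invfM; ring.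
  rewrite esum_mul; first last.
  - by move=> nu; rewrite mulr_ge0 ?Qstrip_ge0 ?schurP_ge0.
  - apply: mulr_ge0 (Qstrip_ge0 _ _ y0); apply: mulr_ge0 (pow_ge0 _).
    exact: mulr_ge0 C0 (exprn_ge0 _ (ler0n _ _)).
  rewrite IH -EFinM; congr EFin; rewrite /schurP.
  have two : (2 ^+ size ka : R) != 0 by rewrite expf_neq0 // pnatr_eq0.
  have two' : (2 ^+ size mu : R) != 0 by rewrite expf_neq0 // pnatr_eq0.
  by field; rewrite two two'.
have F0 : 0 <= cauchy_factor x Y by apply: cauchy_factor_ge0.
rewrite esum_mul; first last.
- by move=> ka; rewrite mulr_ge0 ?Qstrip_ge0 ?schurQ_ge0.
- exact: mulr_ge0 (mulr_ge0 C0 F0) (pow_ge0 _).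
rewrite esum_schurQ_cons // -EFinM; congr EFin.
have -> : cauchy_factor x (y :: Y) = C * cauchy_factor x Y.
  by rewrite /cauchy_factor big_cons.
by rewrite /schurP; ring.
Qed.

(** Each variable of [Z] contributes one strip, which the Pieri rule sums. *)
Lemma cauchy_identity Z Y : (forall z, z \in Z -> 0 <= z) -> (forall y, y \in Y -> 0 <= y) ->
  (forall z y, z \in Z -> y \in Y -> z * y < 1) ->
  (\esum_(la in setT) (schurQ la Z * schurP la Y)%:E =
   (\prod_(z <- Z) cauchy_factor z Y)%:E)%E.
Proof.
move=> Z0 Y0; elim: Z Z0 => [|z Z IH] Z0 ZY.
  rewrite big_nil esum_empty_partition; first last.
  - by move=> la ne; rewrite schurQ_nil largest_eq0 (negbTE ne) mul0r.
  - by move=> la; rewrite mulr_ge0 ?schurQ_ge0 ?schurP_ge0.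
  by rewrite /schurP !schurQ_empty /= expr0 invr1 !mul1r.
have z0 : 0 <= z by apply: Z0; rewrite mem_head.
have Z0' t : t \in Z -> 0 <= t by move=> tZ; apply: Z0; rewrite inE tZ orbT.
have zY y : y \in Y -> 0 <= y /\ z * y < 1.
  by move=> yY; split; [exact: Y0 | apply: ZY; rewrite ?mem_head].
have {}IH : (\esum_(la in setT) (schurQ la Z * schurP la Y)%:E =
   (\prod_(z <- Z) cauchy_factor z Y)%:E)%E.
  by apply: IH => // t y tZ yY; apply: ZY; rewrite // inE tZ orbT.
transitivity (\esum_(la in setT) \esum_(mu in setT)
    (schurP la Y * (Qstrip z la mu * schurQ mu Z))%:E)%E.
  apply: eq_esum => la _; rewrite esum_mul ?schurP_ge0 //; last first.
    by move=> mu; rewrite mulr_ge0 ?Qstrip_ge0 ?schurQ_ge0.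
  by rewrite esum_schurQ_cons // -EFinM mulrC.
rewrite esum_setT_swap; last first.
  move=> la mu; rewrite lee_fin.
  exact: mulr_ge0 (schurP_ge0 _ Y0) (mulr_ge0 (Qstrip_ge0 _ _ z0) (schurQ_ge0 _ Z0')).
transitivity (\esum_(mu in setT)
    (cauchy_factor z Y * (schurQ mu Z * schurP mu Y))%:E)%E.
  apply: eq_esum => mu _.
  transitivity (\esum_(la in setT) (schurQ mu Z * (Qstrip z la mu * schurP la Y))%:E)%E.
    by apply: eq_esum => la _; congr EFin; ring.
  rewrite esum_mul ?schurQ_ge0 //; last first.
    by move=> la; rewrite mulr_ge0 ?Qstrip_ge0 ?schurP_ge0.
  by rewrite pieri // -EFinM; congr EFin; ring.
rewrite esum_mul; first last.
- by move=> mu; rewrite mulr_ge0 ?schurQ_ge0 ?schurP_ge0.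
- exact: cauchy_factor_ge0.
by rewrite IH -EFinM big_cons.
Qed.

End CauchyIdentity.

(** * Skew functions and the law of the pair *)

Section SkewFunctions.
Variable R : realType.
Implicit Types (x y q u v : R) (A B X Y : seq R) (la mu nu : strict_partition).

Lemma subpartP mu la :
  reflect (forall i, (nth 0 (parts mu) i <= nth 0 (parts la) i)%N) (subpart mu la).
Proof.
apply: (iffP forallP) => H i; last exact: H.
have [lt|le] := ltnP i (size mu); first exact: (H (Ordinal lt)).
by rewrite nth_default.
Qed.

Lemma subpart_trans nu mu la : subpart mu nu -> subpart nu la -> subpart mu la.
Proof.
move=> /subpartP mn /subpartP nl; apply/subpartP => i.
exact: leq_trans (mn i) (nl i).
Qed.

Lemma subpart_refl la : subpart la la.
Proof. exact/subpartP. Qed.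

(** The skew function [Q_(la/mu)(A)], as a sum over chains of strips. *)
Fixpoint iterated_strip A la mu : R :=
  if A is a :: A' then
    \sum_(nu <- partitions (largest la)) Qstrip a la nu * iterated_strip A' nu mu
  else (mu == la)%:R.

Lemma iterated_strip_subpart A la mu : iterated_strip A la mu != 0 -> subpart mu la.
Proof.
elim: A la => [|a A IH] la /=.
  by have [->|ne] := eqVneq mu la; rewrite ?subpart_refl // eqxx.
apply: contraNT => notsub; rewrite big1 // => nu _; apply/eqP.
rewrite mulf_eq0 -[_ == 0]negbK -[iterated_strip _ _ _ == 0]negbK -negb_and.
apply: contra notsub => /andP[/Qstrip_subpart nl /IH mn].
exact: subpart_trans mn nl.
Qed.

Lemma schurQ_cat A B la n : (largest la <= n)%N ->
  schurQ la (A ++ B) = \sum_(mu <- partitions n) iterated_strip A la mu * schurQ mu B.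
Proof.
elim: A la => [|a A IH] la la_n /=.
  rewrite (bigD1_seq la) ?uniq_partitions ?mem_partitions //= eqxx mul1r big1 ?addr0 //.
  by move=> mu; case: eqP => // _ _; rewrite mul0r.
rewrite (schurQ_cons a _ (leqnn _)).
under [RHS]eq_bigr do rewrite mulr_suml.
rewrite exchange_big /=; apply: eq_big_seq => nu; rewrite mem_partitions => nu_la.
rewrite IH ?(leq_trans nu_la) // mulr_sumr.
by apply: eq_bigr => mu _; rewrite mulrA.
Qed.

Lemma subpart_fsum la n (F : strict_partition -> R) : (largest la <= n)%N ->
  \sum_(mu \in [set mu | subpart mu la]) F mu =
  \sum_(mu <- partitions n) (if subpart mu la then F mu else 0).
Proof.
move=> la_n.
transitivity (\sum_(mu \in [set mu | subpart mu la]) (if subpart mu la then F mu else 0)).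
  by apply: eq_fsbigr => mu; rewrite inE /= => ->.
apply: fsbig_fwiden.
- move=> mu /= /subpart_largest; rewrite mem_partitions => mu_la.
  exact: leq_trans mu_la la_n.
- exact: uniq_partitions.
- by move=> mu [_ /= /negP/negbTE ->].
Qed.

Lemma skewQ_coefs_exist la A : skewQ_coefs la A (iterated_strip A la).
Proof.
move=> B; rewrite (subpart_fsum _ (leqnn _)) (schurQ_cat A B (leqnn _)).
apply: eq_bigr => mu _; case: ifPn => // notsub.
have [->|/iterated_strip_subpart] := eqVneq (iterated_strip A la mu) 0.
  by rewrite mul0r.
by rewrite (negbTE notsub).
Qed.

Lemma skewQ_spec la A : skewQ_coefs la A (skewQ la ^~ A).
Proof. exact: (xgetPex _ (ex_intro _ _ (skewQ_coefs_exist la A))). Qed.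

Lemma Qstrip_scale c x la mu :
  Qstrip (c * x) la mu * c ^+ weight mu = c ^+ weight la * Qstrip x la mu.
Proof.
rewrite /Qstrip; set n := maxn _ _.
have := strip_scale c x false (size_tobits n la) (size_tobits n mu).
by rewrite -/(to_bits n la) -/(to_bits n mu) !occupied_to_bits ?leq_maxl ?leq_maxr.
Qed.

Lemma schurQ_scale c A la :
  schurQ la (scale_alphabet c A) = c ^+ weight la * schurQ la A.
Proof.
elim: A la => [|a A IH] la.
  rewrite /= schurQ_nil largest_eq0; case: eqVneq => [->|]; last by rewrite mulr0.
  by rewrite /weight /= expr0 mul1r.
rewrite /= -/(scale_alphabet c A) !(schurQ_cons _ _ (leqnn _)) mulr_sumr.
by apply: eq_bigr => mu _; rewrite IH mulrA Qstrip_scale -mulrA.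
Qed.

Lemma schurQ_pair_sum q u v X la n : (largest la <= n)%N ->
  schurQ la (scale_alphabet v X ++ scale_alphabet (u * v * q) X) =
  \sum_(mu <- partitions n) (if subpart mu la then
     u ^+ weight mu * v ^+ weight la *
     (schurQ mu (scale_alphabet q X) * skewQ la mu X) else 0).
Proof.
move=> la_n.
have -> : scale_alphabet v X ++ scale_alphabet (u * v * q) X =
    scale_alphabet v (X ++ scale_alphabet u (scale_alphabet q X)).
  rewrite /scale_alphabet map_cat -!map_comp; congr (_ ++ _).
  by apply: eq_map => x /=; ring.
rewrite schurQ_scale skewQ_spec (subpart_fsum _ la_n) mulr_sumr.
apply: eq_bigr => mu _; case: ifP; rewrite ?mulr0 // schurQ_scale => _; ring.
Qed.

(** For fixed [la], homogeneity and the defining property of the skew functions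
    turn the sum over [mu] into [Q_la] of the alphabet [v X + u v q X]; the sum over
    [la] is then the Cauchy identity. *)
Lemma pair_law_gf q u v X Y :
  (forall mu la, 0 <= pair_law q X Y mu la) -> 0 <= u -> 0 <= v -> 0 <= q ->
  (forall x, x \in X -> 0 <= x) -> (forall y, y \in Y -> 0 <= y) ->
  (forall x y, x \in X -> y \in Y -> v * x * y < 1 /\ u * v * q * x * y < 1) ->
  (\esum_(la in setT) \esum_(mu in setT)
     (u ^+ weight mu * v ^+ weight la * pair_law q X Y mu la)%:E =
  ((sfH (scale_alphabet q X) Y * sfH X Y)^-1 *
   ((\prod_(x <- X) cauchy_factor (v * x) Y) *
    (\prod_(x <- X) cauchy_factor (u * v * q * x) Y)))%:E)%E.
Proof.
move=> law0 u0 v0 q0 X0 Y0 XY1.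
set K := (_ * _)^-1; pose Z := scale_alphabet v X ++ scale_alphabet (u * v * q) X.
have K0 : 0 <= K by rewrite invr_ge0; apply: mulr_ge0; apply: expR_ge0.
have Z0 z : z \in Z -> 0 <= z.
  by rewrite mem_cat => /orP[] /mapP[x xX ->]; rewrite ?mulr_ge0 // X0.
have ZY z y : z \in Z -> y \in Y -> z * y < 1.
  by rewrite mem_cat => /orP[] /mapP[x xX ->] yY; have [] := XY1 x y xX yY.
transitivity (\esum_(la in setT) (K * (schurQ la Z * schurP la Y))%:E)%E.
  apply: eq_esum => la _.
  apply: (esum_exhaust uniq_partitions near_partitions) => [mu|].
    by rewrite !mulr_ge0 ?exprn_ge0.
  apply: cvg_near_cst; exists (largest la) => // n /= la_n.
  rewrite (schurQ_pair_sum q u v X la_n) mulr_suml mulr_sumr.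
  apply: eq_bigr => mu _; rewrite /pair_law -/K; case: ifP => _;
    last by rewrite !(mulr0, mul0r).
  by ring.
rewrite esum_mul //; last by move=> la; rewrite mulr_ge0 ?schurQ_ge0 ?schurP_ge0.
rewrite cauchy_identity // -EFinM /Z big_cat /scale_alphabet !big_map.
by [].
Qed.

End SkewFunctions.

(** * The moment generating function *)

Section CountableExpectation.
Context d (T : measurableType d) (R : realType) (P : probability T R).
Variables (I : countType) (W : T -> I).
Hypothesis measurable_fiber : forall i, measurable [set w | W w = i].

Lemma measurable_preimage_countable (D : set I) : measurable (W @^-1` D).
Proof.
have -> : W @^-1` D = \bigcup_i [set w | W w = i /\ D i].
  by apply/seteqP; split=> [w /= Dw|w [i _ [<- Di]]] //; exists (W w).
apply: countable_bigcupT_measurable => // i.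
have [Yi|nYi] := pselect (D i).
  rewrite (_ : [set w | _] = [set w | W w = i]) //.
  by apply/seteqP; split=> [w []|w].
rewrite (_ : [set w | _] = set0) //.
by apply/seteqP; split=> [w []|w].
Qed.

(** The fibers of [W], numbered by [pickle], partition the space, and the
    integrand is constant on each of them. *)
Lemma integral_countable_comp (f : I -> R) : (forall i, 0 <= f i) ->
  (\int[P]_w (f (W w))%:E =
   \esum_(i in setT) ((f i)%:E * P [set w | W w = i]))%E.
Proof.
move=> f0; pose F n := [set w | pickle (W w) = n].
have FE i : F (pickle i) = [set w | W w = i].
  by apply/seteqP; split=> [w /(pcan_inj pickleK)|w wi] //; rewrite /F /= wi.
have F0 n : ~ range (@pickle I) n -> F n = set0.
  move=> nr; apply/seteqP; split=> // w /= wn; apply: nr.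
  by exists (W w).
have mF n : measurable (F n).
  have [[i _ <-]|nr] := pselect (range (@pickle I) n); first by rewrite FE.
  by rewrite F0.
have FT : \bigcup_n F n = setT.
  by apply/seteqP; split=> // w _; exists (pickle (W w)).
have -> : (\int[P]_w (f (W w))%:E = \int[P]_(w in \bigcup_n F n) (f (W w))%:E)%E.
  by rewrite FT.
rewrite ge0_integral_bigcup //; first last.
- by move=> i j _ _ [w [<- <-]].
- by move=> w _; rewrite lee_fin.
- rewrite FT; move=> _ B _; rewrite setTI.
  exact: (measurable_preimage_countable ((fun i => (f i)%:E) @^-1` B)).
rewrite nneseries_esumT; last by move=> n; apply: integral_ge0 => w _; rewrite lee_fin.
transitivity (\esum_(n in range (@pickle I)) \int[P]_(w in F n) (f (W w))%:E)%E.
  rewrite [RHS]esum_mkcond; apply: eq_esum => n _; case: ifPn => //.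
  by rewrite notin_setE => /F0 ->; rewrite integral_set0.
rewrite esum_image; last by move=> i j _ _; apply: (pcan_inj pickleK).
apply: eq_esum => i _; rewrite FE -integral_cst //.
by apply: eq_integral => w; rewrite inE /= => ->.
Qed.

End CountableExpectation.

Section MomentGeneratingFunction.
Context d (T : measurableType d) (R : realType) (P : probability T R).
Variables (q : R) (X Y : seq R).
Hypothesis hq : 0 <= q.
Hypothesis hX : forall x, x \in X -> 0 <= x.
Hypothesis hY : forall y, y \in Y -> 0 <= y.
Variables (M L : T -> strict_partition).
Hypothesis hmeas : forall mu la, measurable [set w | M w = mu /\ L w = la].
Hypothesis hlaw : forall mu la,
  P [set w | M w = mu /\ L w = la] = (pair_law q X Y mu la)%:E.

Lemma pair_law_ge0 mu la : 0 <= pair_law q X Y mu la.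
Proof. by rewrite -lee_fin -hlaw. Qed.

Lemma mgf_pair (al be s : R) :
  let u := expR (s * al) in let v := expR (s * be) in
  (forall x y, x \in X -> y \in Y -> v * x * y < 1 /\ u * v * q * x * y < 1) ->
  ('M_P (fun w => al * (weight (M w))%:R + be * (weight (L w))%:R)%R s =
   ((sfH (scale_alphabet q X) Y * sfH X Y)^-1 *
    ((\prod_(x <- X) cauchy_factor (v * x) Y) *
     (\prod_(x <- X) cauchy_factor (u * v * q * x) Y)))%:E)%E.
Proof.
move=> u v XY1; rewrite -(pair_law_gf pair_law_ge0) ?expR_ge0 //.
rewrite (esum_esum (J := fun=> setT)); last first.
  by move=> la mu _ _; rewrite lee_fin !mulr_ge0 ?exprn_ge0 ?expR_ge0 // pair_law_ge0.
pose W w := (L w, M w).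
have mW i : measurable [set w | W w = i].
  rewrite (_ : [set w | _] = [set w | M w = i.2 /\ L w = i.1]) //.
  case: i => la mu; apply/seteqP.
  by split=> [w /= [<- <-] //|w /= [<- <-]].
have := @integral_countable_comp _ _ _ P _ W mW
  (fun k => u ^+ weight k.2 * v ^+ weight k.1).
rewrite /mmt_gen_fun unlock => E.
transitivity (\int[P]_w (u ^+ weight (M w) * v ^+ weight (L w))%:E)%E.
  apply: eq_integral => w _ /=; congr EFin.
  rewrite /u /v -!expRM_natl -expRD; congr expR; ring.
rewrite E => [|k]; last by rewrite mulr_ge0 ?exprn_ge0 ?expR_ge0.
have -> : [set: strict_partition] `*`` (fun=> [set: strict_partition]) = setT.
  by apply/seteqP.
apply: eq_esum => -[la mu] _ /=; rewrite [in RHS]EFinM -hlaw; congr (_ * _)%E; congr (P _).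
by apply/seteqP; split=> w; rewrite /W /= => -[-> ->].
Qed.

End MomentGeneratingFunction.

(** * Power series in [e^s] *)

Section PowerSeries.
Variable R : realType.
Implicit Types (c : R^nat) (r z : R).

(** [n * r ^+ n] is at most the sum of the [n] larger powers of [r]. *)
Lemma natmul_exp_le r n : 0 <= r -> r < 1 -> n%:R * r ^+ n <= (1 - r)^-1.
Proof.
move=> r0 r1; have r1' : 0 < 1 - r by rewrite subr_gt0.
apply: (@le_trans _ _ (\sum_(i < n) r ^+ i)).
  rewrite mulr_natl -[X in _ *+ X]card_ord -sumr_const; apply: ler_sum => i _.
  by apply: ler_wiXn2l => //; [exact: ltW | exact: ltnW].
rewrite -[leRHS]mul1r ler_pdivlMr //.
have := subrX1 r n; have : 0 <= r ^+ n by rewrite exprn_ge0.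
by set S := \sum_(i < n) _; lra.
Qed.

Definition conv_disc c := forall z, `|z| < 1 -> cvgn (pseries c z).

Definition weighted c : R^nat := fun n => n%:R * c n.

(** Pass from [|z|] to a larger radius [r < 1]: the ratio of the terms is the
    bounded sequence [n (|z| / r)^n]. *)
Lemma conv_disc_weighted c : conv_disc c -> conv_disc (weighted c).
Proof.
move=> cvc z z1; pose r := (`|z| + 1) / 2.
have r0 : 0 < r by rewrite divr_gt0 // ltr_wpDl.
have zr : `|z| < r by rewrite /r; lra.
have r1 : r < 1 by rewrite /r; lra.
pose K := (r + 1) / 2.
have rK : `|r| < `|K| by rewrite !ger0_norm /K; lra.
have K1 : `|K| < 1 by rewrite ger0_norm /K; lra.
have cvr := is_cvg_pseries_inside_norm (cvc _ K1) rK.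
apply: normed_cvg.
have rho1 : `|z| / r < 1 by rewrite ltr_pdivrMr // mul1r.
apply: (@series_le_cvg _ _ (fun n => (1 - `|z| / r)^-1 * (`|c n| * r ^+ n))) => [n|n|n|].
- exact: normr_ge0.
- by rewrite !mulr_ge0 ?exprn_ge0 // ?invr_ge0 ?subr_ge0 ltW.
- rewrite /weighted /= !normrM normr_nat normrX.
  have -> : n%:R * `|c n| * `|z| ^+ n = (n%:R * (`|z| / r) ^+ n) * (`|c n| * r ^+ n).
    by rewrite expr_div_n; field; rewrite expf_neq0 ?gt_eqF.
  apply: ler_wpM2r; first by rewrite mulr_ge0 ?exprn_ge0 // ltW.
  by apply: natmul_exp_le => //; rewrite divr_ge0 // ltW.
- exact: is_cvg_seriesZ.
Qed.

Lemma series_diffs c z n :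
  z * series (fun i => pseries_diffs c i * z ^+ i) n =
  series (fun i => weighted c i * z ^+ i) n.+1.
Proof.
rewrite /series /= big_nat_recl // /weighted mul0r mul0r add0r mulr_sumr.
by apply: eq_bigr => i _; rewrite /pseries_diffs exprS; ring.
Qed.

Lemma conv_disc_diffs c : conv_disc c -> conv_disc (pseries_diffs c).
Proof.
move=> cvc z z1; pose K := (`|z| + 1) / 2.
have K0 : 0 < K by rewrite divr_gt0 // ltr_wpDl.
have zK : `|z| < `|K| by rewrite (gtr0_norm K0) /K; lra.
have K1 : `|K| < 1 by rewrite (gtr0_norm K0) /K; lra.
apply: is_cvg_pseries_inside zK.
have cvw : cvgn (pseries (weighted c) K) by apply: conv_disc_weighted.
have -> : pseries (pseries_diffs c) K = (fun n => K^-1 * pseries (weighted c) K n.+1).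
  by apply/funext => n; rewrite /pseries -series_diffs mulKf ?gt_eqF.
apply: is_cvgMl_tmp.
apply/cvg_ex; exists (limn (pseries (weighted c) K)).
by rewrite (cvg_shiftS (pseries (weighted c) K)).
Qed.

Definition psum_series c z : R := limn (pseries c z).

Lemma psum_series_diffs c z : conv_disc c -> `|z| < 1 ->
  psum_series (pseries_diffs c) z * z = psum_series (weighted c) z.
Proof.
move=> cvc z1; have cvd := conv_disc_diffs cvc z1.
have cvw := conv_disc_weighted cvc z1.
have lhs : (fun n => z * pseries (pseries_diffs c) z n) @ \oo -->
    z * psum_series (pseries_diffs c) z.
  exact: cvgMl_tmp.
have rhs : (fun n => z * pseries (pseries_diffs c) z n) @ \oo -->
    psum_series (weighted c) z.
  have -> : (fun n => z * pseries (pseries_diffs c) z n) =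
      (fun n => pseries (weighted c) z n.+1).
    by apply/funext => n; apply: series_diffs.
  by rewrite (cvg_shiftS (pseries (weighted c) z)).
rewrite mulrC; exact: (cvg_unique _ lhs rhs).
Qed.

Lemma is_derive_psum_series c z : conv_disc c -> `|z| < 1 ->
  is_derive z 1 (psum_series c) (psum_series (pseries_diffs c) z).
Proof.
move=> cvc z1; pose K := (`|z| + 1) / 2.
have K0 : 0 < K by rewrite divr_gt0 // ltr_wpDl.
have zK : `|z| < `|K| by rewrite (gtr0_norm K0) /K; lra.
have K1 : `|K| < 1 by rewrite (gtr0_norm K0) /K; lra.
apply: (pseries_snd_diffs (K := K)) => //; first exact: cvc.
  exact: conv_disc_diffs.
exact: (conv_disc_diffs (conv_disc_diffs cvc)).
Qed.

(** By the chain rule the derivative is [z f'(z)] at [z = t e^s], and [z d/dz]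
    multiplies the n-th coefficient by [n]. *)
Lemma is_derive_psum_exp c t s : conv_disc c -> 0 <= t -> t * expR s < 1 ->
  is_derive s 1 (fun s => psum_series c (t * expR s))
    (psum_series (weighted c) (t * expR s)).
Proof.
move=> cvc t0 ts1.
have ts : `|t * expR s| < 1 by rewrite ger0_norm // mulr_ge0 ?expR_ge0.
rewrite -(psum_series_diffs cvc ts).
have Dts : is_derive s 1 (fun s => t * expR s) (t * expR s).
  exact: is_deriveZ.
have Dc := is_derive_psum_series cvc ts.
exact: (@is_derive1_comp R (psum_series c) (fun s => t * expR s) s _ _ Dc Dts).
Qed.

(** The coefficients of [(z d/dz)^(j+1) log ((1 + z) / (1 - z))]. *)
Definition odd_coef j : R^nat := fun n => if odd n then 2 * n%:R ^+ j else 0.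

Lemma odd_coefS j : weighted (odd_coef j) = odd_coef j.+1.
Proof.
apply/funext => n; rewrite /weighted /odd_coef; case: odd; rewrite ?mulr0 //.
by rewrite exprS; ring.
Qed.

Lemma odd_coef0_cvg z : `|z| < 1 ->
  pseries (odd_coef 0) z @ \oo --> (1 - z)^-1 - (1 + z)^-1.
Proof.
move=> z1.
have -> : pseries (odd_coef 0) z =
    (fun n => series (geometric 1 z) n - series (geometric 1 (- z)) n).
  apply/funext => n; rewrite /series /= -sumrB; apply: eq_bigr => i _.
  rewrite /odd_coef /geometric /= !mul1r exprNn -signr_odd.
  by case: odd => /=; rewrite ?expr1 ?expr0; ring.
have geom (u : R) : `|u| < 1 -> series (geometric 1 u) @ \oo --> (1 - u)^-1.
  move=> u1; have g := @cvg_geometric_series R 1 u u1.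
  by rewrite mul1r in g.
have Nz1 : `|- z| < 1 by rewrite normrN.
have geomN := geom _ Nz1; rewrite opprK in geomN.
exact: (cvgB (geom z z1) geomN).
Qed.

Lemma odd_coef_conv j : conv_disc (odd_coef j).
Proof.
elim: j => [|j IH]; last by rewrite -odd_coefS; apply: conv_disc_weighted.
by move=> z z1; apply/cvg_ex; exists ((1 - z)^-1 - (1 + z)^-1); apply: odd_coef0_cvg.
Qed.

End PowerSeries.

(** * Cumulants *)

Section Cumulants.
Variable R : realType.
Implicit Types (ts : seq R).

Lemma near_derive1 (f g g' : R -> R) (a : R) :
  (\forall s \near a, f s = g s) ->
  (\forall s \near a, is_derive (s : R) (1 : R) g (g' s)) ->
  \forall s \near a, derivable f s 1 /\ derive1 f s = g' s.
Proof.
move=> /near_join fg dg; near=> s.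
have fgs : \forall x \near s, g x = f x.
  have : \forall x \near s, f x = g x by near: s; apply: fg.
  by apply: filterS => x ->.
have dgs : is_derive (s : R) (1 : R) g (g' s) by near: s; apply: dg.
have dfs := near_eq_is_derive fgs dgs.
by split; [apply: ex_derive | rewrite derive1E derive_val].
Unshelve. all: by end_near.
Qed.

Lemma is_derive_sum_seq ts (F F' : R -> R -> R) (s : R) :
  (forall t, t \in ts -> is_derive (s : R) (1 : R) (F t) (F' t s)) ->
  is_derive (s : R) (1 : R) (fun s => \sum_(t <- ts) F t s) (\sum_(t <- ts) F' t s).
Proof.
elim: ts => [|t ts IH] H.
  rewrite big_nil; under eq_fun do rewrite big_nil.
  exact: is_derive_cst.
rewrite big_cons; under eq_fun do rewrite big_cons.
apply: is_deriveD; first by apply: H; rewrite mem_head.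
by apply: IH => u uts; apply: H; rewrite inE uts orbT.
Qed.

Lemma cvg_sum_seq ts (f : R -> R^nat) (l : R -> R) :
  (forall t, t \in ts -> f t @ \oo --> l t) ->
  (fun n => \sum_(t <- ts) f t n) @ \oo --> \sum_(t <- ts) l t.
Proof.
elim: ts => [|t ts IH] H.
  by rewrite big_nil; under eq_fun do rewrite big_nil; apply: cvg_cst.
rewrite big_cons; under eq_fun do rewrite big_cons.
apply: cvgD; first by apply: H; rewrite mem_head.
by apply: IH => u uts; apply: H; rewrite inE uts orbT.
Qed.

Lemma near_lt1_expR ts : (forall t, t \in ts -> t < 1) ->
  \forall s \near (0 : R), forall t, t \in ts -> t * expR s < 1.
Proof.
elim: ts => [|t ts IH] H; first by near=> s => t.
have t1 : t < 1 by apply: H; rewrite mem_head.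
have near_t : \forall s \near (0 : R), t * expR s < 1.
  have : (fun s : R => t * expR s) @ (0 : R) --> t * expR 0.
    by apply: cvgMl_tmp; apply: continuous_expR.
  by rewrite expR0 mulr1 => /cvgr_lt; apply.
have near_ts : \forall s \near (0 : R), forall t, t \in ts -> t * expR s < 1.
  by apply: IH => u uts; apply: H; rewrite inE uts orbT.
near=> s => u; rewrite inE => /predU1P[->|]; first by near: s.
by move: u; near: s.
Unshelve. all: by end_near.
Qed.

Lemma ln_prod_ratio ts (C e : R) : 0 < C ->
  (forall t, t \in ts -> 0 <= t * e < 1) ->
  0 < C * \prod_(t <- ts) ((1 + t * e) / (1 - t * e)) /\
  ln (C * \prod_(t <- ts) ((1 + t * e) / (1 - t * e))) =
    ln C + \sum_(t <- ts) (ln (1 + t * e) - ln (1 - t * e)).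
Proof.
move=> C0; elim: ts => [|t ts IH] H.
  by rewrite !big_nil mulr1 addr0.
have /andP[te0 te1] := H t (mem_head _ _).
have [|pos E] := IH; first by move=> u uts; apply: H; rewrite inE uts orbT.
have p1 : 0 < 1 + t * e by rewrite ltr_wpDr.
have p2 : 0 < 1 - t * e by rewrite subr_gt0.
rewrite !big_cons mulrCA; split; first by rewrite mulr_gt0 // divr_gt0.
rewrite lnM ?posrE // ?divr_gt0 // E ln_div ?posrE //.
by rewrite addrCA.
Qed.

Context d (T : measurableType d) (P : probability T R) (V : T -> R).

Lemma mgf0 : ('M_P V 0 = 1)%E.
Proof.
rewrite /mmt_gen_fun unlock -[RHS](@probability_setT _ _ _ P) -[RHS]mul1e.
rewrite -integral_cst //; apply: eq_integral => w _ /=.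
by rewrite mulr0 expR0.
Qed.

Variables (ts : seq R) (C : R).
Hypothesis ts01 : forall t, t \in ts -> 0 <= t < 1.
Hypothesis mgfE : \forall s \near (0 : R),
  'M_P V s = (C * \prod_(t <- ts) ((1 + t * expR s) / (1 - t * expR s)))%:E.

(** The moment generating function takes the value 1 at 0. *)
Lemma mgf_const_gt0 : 0 < C.
Proof.
have := nbhs_singleton mgfE; rewrite /= mgf0 expR0 => -[E].
have pos : 0 < \prod_(t <- ts) ((1 + t * 1) / (1 - t * 1)).
  rewrite big_seq prodr_gt0 // => t /ts01/andP[t0 t1].
  by rewrite mulr1 divr_gt0 ?subr_gt0 // ltr_wpDr.
by rewrite -(pmulr_lgt0 _ pos) -E.
Qed.

(** The successive derivatives of the cumulant generating function near 0. *)
Definition cgf_closed (k : nat) (s : R) : R :=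
  if k is j.+1 then \sum_(t <- ts) psum_series (odd_coef R j) (t * expR s)
  else ln C + \sum_(t <- ts) (ln (1 + t * expR s) - ln (1 - t * expR s)).

Lemma cgf_near : \forall s \near (0 : R), cgf P V s = cgf_closed 0 s.
Proof.
have near_ts := near_lt1_expR (fun t tts => proj2 (andP (ts01 tts))).
near=> s; rewrite /cgf /cgf_closed.
have -> : 'M_P V s = (C * \prod_(t <- ts) ((1 + t * expR s) / (1 - t * expR s)))%:E.
  by near: s.
have lt1 : forall t, t \in ts -> t * expR s < 1 by near: s.
have [|_ -> //] := @ln_prod_ratio ts C (expR s) mgf_const_gt0.
move=> t tts; rewrite lt1 // andbT mulr_ge0 ?expR_ge0 //.
by have /andP[] := ts01 tts.
Unshelve. all: by end_near.
Qed.

Lemma cgf_closed_derive k : \forall s \near (0 : R),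
  is_derive (s : R) (1 : R) (cgf_closed k) (cgf_closed k.+1 s).
Proof.
have near_ts := near_lt1_expR (fun t tts => proj2 (andP (ts01 tts))).
near=> s.
have lt1 : forall t, t \in ts -> t * expR s < 1 by near: s.
have ge0 t : t \in ts -> 0 <= t by move=> /ts01/andP[].
case: k => [|j]; last first.
  apply: (@is_derive_sum_seq ts
    (fun t s => psum_series (odd_coef R j) (t * expR s))
    (fun t s => psum_series (odd_coef R j.+1) (t * expR s))) => t tts.
  rewrite -odd_coefS.
  by apply: is_derive_psum_exp => //; [exact: odd_coef_conv | exact: ge0 | exact: lt1].
have DlnC : is_derive (s : R) (1 : R) (fun=> ln C) 0 by exact: is_derive_cst.
rewrite -[cgf_closed 1 s]add0r; apply: (is_deriveD DlnC).
apply: (@is_derive_sum_seq ts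
  (fun t s => ln (1 + t * expR s) - ln (1 - t * expR s))
  (fun t s => psum_series (odd_coef R 0) (t * expR s))) => t tts.
have te0 : 0 <= t * expR s by rewrite mulr_ge0 ?expR_ge0 ?ge0.
have te1 := lt1 t tts.
have p1 : 0 < 1 + t * expR s by rewrite ltr_wpDr.
have p2 : 0 < 1 - t * expR s by rewrite subr_gt0.
have -> : psum_series (odd_coef R 0) (t * expR s) =
    (1 + t * expR s)^-1 * (t * expR s) - (1 - t * expR s)^-1 * - (t * expR s).
  transitivity ((1 - t * expR s)^-1 - (1 + t * expR s)^-1).
    by apply: cvg_lim => //; apply: odd_coef0_cvg; rewrite ger0_norm.
  by field; rewrite !gt_eqF.
have Dts : is_derive (s : R) (1 : R) (fun s => t * expR s) (t * expR s) by exact: is_deriveZ.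
have D1 : is_derive (s : R) (1 : R) (fun s => 1 + t * expR s) (t * expR s).
  by rewrite -[X in is_derive _ _ _ X]add0r; apply: is_deriveD.
have D2 : is_derive (s : R) (1 : R) (fun s => 1 - t * expR s) (- (t * expR s)).
  by rewrite -[X in is_derive _ _ _ X]add0r; apply: is_deriveD.
apply: is_deriveB.
  exact: (@is_derive1_comp R (@ln R) (fun s => 1 + t * expR s) s _ _ (is_derive1_ln p1) D1).
exact: (@is_derive1_comp R (@ln R) (fun s => 1 - t * expR s) s _ _ (is_derive1_ln p2) D2).
Unshelve. all: by end_near.
Qed.

Lemma derive1n_cgf k : \forall s \near (0 : R), derive1n k (cgf P V) s = cgf_closed k s.
Proof.
elim: k => [|k IH]; first exact: cgf_near.
have := near_derive1 IH (cgf_closed_derive k).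
by apply: filterS => s [_]; rewrite derive1nS.
Qed.

(** Near 0, [log E(e^(sV))] is a constant plus the sum over [t] of
    [log ((1 + t e^s) / (1 - t e^s))], that is, of the series
    [2 t^n e^(n s) / n] over odd [n]; each derivative multiplies the terms by [n]. *)
Lemma cumulant_of_mgf m : (1 <= m)%N ->
  cumulant_is P V m (fun N => 2 * odd_sums (fun n =>
    n%:R ^+ (m - 1) * \sum_(t <- ts) t ^+ n) N).
Proof.
case: m => // j _; rewrite subn1 /=; split; first split.
- by apply: filterS mgfE => s ->; rewrite ltry.
- move=> k _; have := near_derive1 (derive1n_cgf k) (cgf_closed_derive k).
  by apply: filterS => s [].
rewrite /cumulant (nbhs_singleton (derive1n_cgf j.+1)) /= expR0.
under eq_bigr do rewrite mulr1.
have -> : (fun N => 2 * odd_sums (fun n => n%:R ^+ j * \sum_(t <- ts) t ^+ n) N) =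
    (fun N => \sum_(t <- ts) pseries (odd_coef R j) t N).
  apply/funext => N; rewrite /odd_sums /pseries /series /= exchange_big /=.
  rewrite mulr_sumr [in LHS]big_mkcond /=.
  case: N => [|N]; first by rewrite !big_geq.
  rewrite [RHS]big_ltn //= [X in X + _]big1 ?add0r; last first.
    by move=> t _; rewrite /odd_coef /= mul0r.
  apply: eq_bigr => n _; rewrite /odd_coef; case: ifP => _.
    by rewrite !mulr_sumr; apply: eq_bigr => t _; rewrite mulrA.
  by rewrite big1 // => t _; rewrite mul0r.
apply: cvg_sum_seq => t /ts01/andP[t0 t1].
by apply: odd_coef_conv; rewrite ger0_norm.
Qed.

End Cumulants.

(** * The three cumulants *)

Section Products.
Variable R : realType.
Implicit Types (c : R) (X Y : seq R).

Definition products c X Y : seq R := [seq c * x * y | x <- X, y <- Y].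

Lemma sum_products c X Y n :
  \sum_(t <- products c X Y) t ^+ n = c ^+ n * psum n X * psum n Y.
Proof.
rewrite /products big_allpairs_dep /psum -mulrA mulr_suml mulr_sumr; apply: eq_bigr => x _.
by rewrite !mulr_sumr; apply: eq_bigr => y _; rewrite !exprMn mulrA.
Qed.

Lemma prod_products c e X Y :
  \prod_(t <- products c X Y) ((1 + t * e) / (1 - t * e)) =
  \prod_(x <- X) cauchy_factor (e * c * x) Y.
Proof.
rewrite /products big_allpairs_dep; apply: eq_bigr => x _; apply: eq_bigr => y _.
by rewrite [c * x * y * e]mulrC !mulrA.
Qed.

Lemma prod_products1 e X Y :
  \prod_(t <- products 1 X Y) ((1 + t * e) / (1 - t * e)) =
  \prod_(x <- X) cauchy_factor (e * x) Y.
Proof. by rewrite prod_products; under eq_bigr do rewrite mulr1. Qed.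

Lemma products_bound c X Y : 0 <= c ->
  (forall x, x \in X -> 0 <= x) -> (forall y, y \in Y -> 0 <= y) ->
  (forall x y, x \in X -> y \in Y -> c * x * y < 1) ->
  forall t, t \in products c X Y -> 0 <= t < 1.
Proof.
move=> c0 X0 Y0 XY1 t /allpairsP[[x y] /= [xX yY ->]].
by rewrite XY1 // andbT (mulr_ge0 (mulr_ge0 c0 (X0 _ xX)) (Y0 _ yY)).
Qed.

Lemma near_products c X Y :
  (forall x y, x \in X -> y \in Y -> c * x * y < 1) ->
  \forall s \near (0 : R), forall x y, x \in X -> y \in Y -> expR s * c * x * y < 1.
Proof.
move=> XY1.
have : \forall s \near (0 : R), forall t, t \in products c X Y -> t * expR s < 1.
  by apply: near_lt1_expR => t /allpairsP[[x y] /= [xX yY ->]]; apply: XY1.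
apply: filterS => s H x y xX yY.
by rewrite -!mulrA mulrC !mulrA H //; apply: allpairs_f.
Qed.

End Products.

Theorem theorem6p2 (R : realType) (q : R) (X Y : seq R)
    (hq : 0 <= q)
    (hX : forall x, x \in X -> 0 <= x) (hY : forall y, y \in Y -> 0 <= y)
    (hXY : forall x y, x \in X -> y \in Y -> Num.max 1 q * x * y < 1)
    (d : measure_display) (T : measurableType d) (P : probability T R)
    (M L : T -> strict_partition)
    (hmeas : forall mu la, measurable [set w | M w = mu /\ L w = la])
    (hlaw : forall mu la,
       P [set w | M w = mu /\ L w = la] = (pair_law q X Y mu la)%:E)
    (m : nat) (hm : (1 <= m)%N) :
  let B := fun w : T => (weight (M w))%:R : R in
  let Rr := fun w : T => (weight (L w))%:R - (weight (M w))%:R : R in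
  let La := fun w : T => (weight (L w))%:R : R in
  [/\ cumulant_is P B m (fun N => 2 * odd_sums (fun n =>
        n%:R ^+ (m - 1) * q ^+ n * psum n X * psum n Y) N),
      cumulant_is P Rr m (fun N => 2 * odd_sums (fun n =>
        n%:R ^+ (m - 1) * psum n X * psum n Y) N) &
      cumulant_is P La m (fun N => 2 * odd_sums (fun n =>
        n%:R ^+ (m - 1) * (1 + q ^+ n) * psum n X * psum n Y) N)].
Proof.
move=> B Rr La.
have XY1 x y : x \in X -> y \in Y -> 1 * x * y < 1.
  move=> xX yY; apply: le_lt_trans (hXY x y xX yY).
  apply: (ler_wpM2r (hY _ yY)); apply: (ler_wpM2r (hX _ xX)).
  by rewrite le_max lexx.
have qXY1 x y : x \in X -> y \in Y -> q * x * y < 1.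
  move=> xX yY; apply: le_lt_trans (hXY x y xX yY).
  apply: (ler_wpM2r (hY _ yY)); apply: (ler_wpM2r (hX _ xX)).
  by rewrite le_max lexx orbT.
have near1 := near_products XY1.
have nearq := near_products qXY1.
have bound1 := products_bound ler01 hX hY XY1.
have boundq := products_bound hq hX hY qXY1.
(* The value at 0 will determine the constant, so that only its existence
   matters here. *)
have [K mgf] : exists K : R, forall al be s v w : R,
    expR (s * be) = v -> expR (s * al) * v = w ->
    (forall x y, x \in X -> y \in Y -> v * x * y < 1 /\ w * q * x * y < 1) ->
    ('M_P (fun w => al * (weight (M w))%:R + be * (weight (L w))%:R)%R s =
     (K * ((\prod_(x <- X) cauchy_factor (v * x) Y) *
           (\prod_(x <- X) cauchy_factor (w * q * x) Y)))%:E)%E.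
  by eexists => al be s v w <- <-; apply: mgf_pair.
pose C c := \prod_(x <- X) cauchy_factor (c * x) Y.
have BE : B = (fun w => 1 * (weight (M w))%:R + 0 * (weight (L w))%:R).
  by apply/funext => w; rewrite mul1r mul0r addr0.
have RE : Rr = (fun w => -1 * (weight (M w))%:R + 1 * (weight (L w))%:R).
  by apply/funext => w; rewrite mul1r mulN1r addrC.
have LE : La = (fun w => 0 * (weight (M w))%:R + 1 * (weight (L w))%:R).
  by apply/funext => w; rewrite mul1r mul0r add0r.
have exp1 s : expR (s * 1) = expR s :> R by rewrite mulr1.
have exp0 s : expR (s * 0) = 1 :> R by rewrite mulr0 expR0.
split.
- have : \forall s \near (0 : R), ('M_P B s = (K * C 1 *
      \prod_(t <- products q X Y) ((1 + t * expR s) / (1 - t * expR s)))%:E)%E.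
    near=> s; rewrite BE (mgf 1 0 s 1 (expR s)) ?mulr1 //.
      by rewrite prod_products mulrA.
    move=> x y xX yY; split; first exact: XY1.
    by move: x y xX yY; near: s.
  move/(cumulant_of_mgf boundq)/(_ m hm); congr cumulant_is.
  apply/funext => N; congr (_ * _); apply: eq_bigr => n _.
  by rewrite sum_products !mulrA.
- have : \forall s \near (0 : R), ('M_P Rr s = (K * C q *
      \prod_(t <- products 1 X Y) ((1 + t * expR s) / (1 - t * expR s)))%:E)%E.
    near=> s; rewrite RE (mgf (-1) 1 s (expR s) 1) //.
    + by rewrite prod_products1 -mulrA mul1r [C q * _]mulrC.
    + by rewrite -expRD mulrN1 addNr expR0.
    move=> x y xX yY; rewrite mul1r; split; last exact: qXY1.
    by rewrite -[expR s]mulr1; move: x y xX yY; near: s.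
  move/(cumulant_of_mgf bound1)/(_ m hm); congr cumulant_is.
  apply/funext => N; congr (_ * _); apply: eq_bigr => n _.
  by rewrite sum_products expr1n mul1r !mulrA.
- have : \forall s \near (0 : R), ('M_P La s = (K *
      \prod_(t <- products 1 X Y ++ products q X Y)
        ((1 + t * expR s) / (1 - t * expR s)))%:E)%E.
    near=> s; rewrite LE (mgf 0 1 s (expR s) (expR s)) //.
    + by rewrite big_cat /= prod_products1 prod_products.
    + by rewrite exp0 mul1r.
    move=> x y xX yY; split; last by move: x y xX yY; near: s.
    by rewrite -[expR s]mulr1; move: x y xX yY; near: s.
  have bounds t : t \in products 1 X Y ++ products q X Y -> 0 <= t < 1.
    by rewrite mem_cat => /orP[/bound1|/boundq].
  move/(cumulant_of_mgf bounds)/(_ m hm); congr cumulant_is.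
  apply/funext => N; congr (_ * _); apply: eq_bigr => n _.
  by rewrite big_cat /= !sum_products expr1n; ring.
Unshelve. all: by end_near.
Qed.
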